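(* Let $r\ge s$ be positive integers. For each $1\le k\le s-1$, the map $\zeta_k\colon\mathbb R_+^{I_{k+1}}\to\mathbb R_+^{I_k}$ is equivariant with respect to the action of polygonal rowmotion: $$\zeta_k\circ\tilde\varrho_{k+1}=\tilde\varrho_k\circ\zeta_k.$$
   Context: All posets are finite, $\mathbb R_+$ denotes the positive reals, and $[n]=\{1,\dots,n\}$. Posets (all with the componentwise order): the right trapezoid $RT_{r,s}=\{(i,j)\in[r+s-1]\times[s] : i-j<r\}$; the trapezoid $T_{r,s}=\{(i,j)\in RT_{r,s}: i+j>s\}$. For $1\le k\le s$ the intermediate poset $I_k$ is the induced subposet of $RT_{r,s}$ on $T_{r,k}\cup[(k,k+1),(r+k-1,s)]$ (the second set is an interval of $RT_{r,s}$, empty when $k=s$). The left border of $RT_{r,s}$ is $L=\{(\ell+r-1,\ell):1\le\ell\le s\}$. Antichain rowmotion: for a poset $P$ and $p\in P$, the toggle $\tau_p\colon\mathbb R_+^P\to\mathbb R_+^P$ replaces $x_p$ by $\left(\sum_{C}\prod_{q\in C}x_q\right)^{-1}$, where $C$ ranges over all maximal chains of $P$ containing $p$, and fixes all other coordinates. Then $\tilde\rho=\tau_{\lambda^{-1}(n)}\circ\cdots\circ\tau_{\lambda^{-1}(1)}$ for any linear extension $\lambda\colon P\to[n]$; it is a bijection independent of $\lambda$. The maps $\zeta_k$: let $M_k$ be the interval $[(k,1),(r+k,k+1)]$ of $RT_{r,s}$ and let $\tilde\rho_k$ be antichain rowmotion on $M_k$. For $x\in\mathbb R_+^{I_{k+1}}$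 let $\bar x\in\mathbb R_+^{M_k}$ be obtained by restricting $x$ to $M_k\setminus\{(k,1)\}\subseteq I_{k+1}$ and setting $\bar x_{k,1}=1$ (any positive value gives the same map). Then $$\zeta_k(x)_{ij}=\begin{cases}\tilde\rho_k^{-1}(\bar x)_{ij}&\text{if }(i,j)\in I_k\cap M_k=M_k\setminus\{(r+k,k+1)\},\\ x_{i+1,j}&\text{if }(i,j)\in I_k\setminus M_k\text{ and }j>k+1,\\ x_{i,j+1}&\text{if }(i,j)\in I_k\setminus M_k\text{ and }i<k.\end{cases}$$ Polygonal rowmotion: a maximal chain $C$ of $I_k$ is polygonal if $C\cap L\neq\varnothing$ or $(k,1)\in C$. For $p\in I_k$, the polygonal toggle $\tau'_p\colon\mathbb R_+^{I_k}\to\mathbb R_+^{I_k}$ replaces $x_p$ by $\left(\sum_C\prod_{q\in C}x_q\right)^{-1}$, where $C$ ranges over all polygonal chains of $I_k$ containing $p$, and fixes all other coordinates. Polygonal rowmotion on $I_k$ is $\tilde\varrho_k=\tau'_{\lambda^{-1}(|I_k|)}\circ\cdots\circ\tau'_{\lambda^{-1}(1)}$ for any linear extension $\lambda\colon I_k\to[|I_k|]$; it is independent of $\lambda$. *)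

(* Defs.v *)
From mathcomp Require Import all_boot all_order all_algebra.
From mathcomp Require Import reals.

Set Implicit Arguments.
Unset Strict Implicit.
Unset Printing Implicit Defensive.

Import Order.TTheory GRing.Theory Num.Theory.
Local Open Scope ring_scope.

(* A finite poset is a subset [P] of an ambient finite partially ordered type  *)
(* [T], with the induced order.  A labeling in R_+^P is a function on [T] that *)
(* is positive on [P]; its values outside [P] are irrelevant.                  *)

Section Toggles.
Variables (R : realType) (d : Order.disp_t) (T : finPOrderType d).
Implicit Types (P C : {set T}) (F : {set {set T}}) (p q : T) (w : seq T).
Implicit Types x y : {ffun T -> R}.

Definition positive_on P x : Prop := forall p, p \in P -> 0 < x p.

Definition is_chain C : bool :=
  [forall p in C, forall q in C, (p >=< q)%O].

Definition max_chains P : {set {set T}} :=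
  [set C | maxset [pred D : {set T} | (D \subset P) && is_chain D] C].

(* A linear extension lambda : P -> [n] is given by the list                   *)
(* [:: lambda^-1(1); ...; lambda^-1(n)], so that lambda p - 1 = index p w.     *)
Definition linear_extension P w : Prop :=
  [/\ uniq w, w =i P &
      forall p q, p \in P -> q \in P -> (p < q)%O -> (index p w < index q w)%N].

(* The toggle at p relative to a family F of chains: F is the family of all    *)
(* maximal chains for antichain rowmotion, and of the polygonal chains for     *)
(* polygonal rowmotion.                                                        *)
Definition toggle F p x : {ffun T -> R} :=
  [ffun q => if q == p
             then (\sum_(C in F | p \in C) \prod_(c in C) x c)^-1
             else x q].

(* The head of the list is toggled first. *)
Definition toggles F w x : {ffun T -> R} :=
  foldl (fun y p => toggle F p y) x w.

Definition rowmotion P w x : {ffun T -> R} := toggles (max_chains P) w x.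

(* Toggles are involutions, so the inverse of rowmotion performs them in the   *)
(* opposite order; see [rowmotionK] and [rowmotion_invK].                      *)
Definition rowmotion_inv P w x : {ffun T -> R} :=
  toggles (max_chains P) (rev w) x.

Lemma max_chainsS P C : C \in max_chains P -> C \subset P.
Proof. by rewrite inE => /maxsetp /= /andP[]. Qed.

Lemma max_chains_ex P p : p \in P -> exists2 C, C \in max_chains P & p \in C.
Proof.
move=> pP.
have [|C CM sC] := @maxset_exists _
    [pred D : {set T} | (D \subset P) && is_chain D] [set p].
  rewrite /= sub1set pP /=; apply/forall_inP => a /set1P ->.
  by apply/forall_inP => b /set1P ->; exact: comparablexx.
by exists C; rewrite ?inE // -sub1set.
Qed.

Lemma toggle_positive P p x :
  p \in P -> positive_on P x -> positive_on P (toggle (max_chains P) p x).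
Proof.
move=> pP x0 q qP; rewrite ffunE; case: eqP => _; last exact: x0.
have [C CM pC] := max_chains_ex pP.
have ge0 D : D \in max_chains P -> 0 < \prod_(c in D) x c.
  move=> /max_chainsS/subsetP sD; apply: prodr_gt0 => c cD.
  exact: x0 (sD _ cD).
rewrite invr_gt0 (bigD1 C) /=; last by rewrite CM.
rewrite ltr_wpDr ?ge0 //; apply: sumr_ge0 => D /andP[/andP[DM _] _].
exact/ltW/ge0.
Qed.

Lemma toggleK P p x : p \in P -> positive_on P x ->
  toggle (max_chains P) p (toggle (max_chains P) p x) = x.
Proof.
move=> pP x0; have y0 := toggle_positive pP x0.
pose A := \sum_(C in max_chains P | p \in C) \prod_(c in C | c != p) x c.
have E y : {in predC1 p, y =1 x} ->
    \sum_(C in max_chains P | p \in C) \prod_(c in C) y c = y p * A.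
  move=> yx; rewrite mulr_sumr; apply: eq_bigr => C /andP[_ pC].
  rewrite (bigD1 p) //=; congr (_ * _); apply: eq_bigr => c /andP[_ cp].
  exact: yx.
apply/ffunP => q; rewrite ffunE; case: eqP => [->|/eqP qp]; last first.
  by rewrite ffunE (negPf qp).
rewrite E; last by move=> c cp; rewrite ffunE (negPf cp).
have := y0 _ pP; rewrite ffunE eqxx E // => xA0.
have A0 : A != 0.
  by apply: contraTneq xA0 => ->; rewrite mulr0 invr0 ltxx.
by rewrite invfM invrK mulfK.
Qed.

Lemma toggles_positive P w x : {subset w <= P} -> positive_on P x ->
  positive_on P (toggles (max_chains P) w x).
Proof.
elim: w x => //= p w IH x sw x0; apply: IH => [q qw|].
  by apply: sw; rewrite inE qw orbT.
by apply: toggle_positive => //; apply: sw; rewrite inE eqxx.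
Qed.

Lemma toggles_revK P w x : {subset w <= P} -> positive_on P x ->
  toggles (max_chains P) (rev w) (toggles (max_chains P) w x) = x.
Proof.
elim: w x => //= p w IH x sw x0.
have pP : p \in P by apply: sw; rewrite inE eqxx.
have swP : {subset w <= P} by move=> q qw; apply: sw; rewrite inE qw orbT.
rewrite rev_cons /toggles foldl_rcons -!/(toggles _ _ _).
by rewrite IH ?toggleK //; exact: toggle_positive.
Qed.

Lemma rowmotionK P w x : linear_extension P w -> positive_on P x ->
  positive_on P (rowmotion P w x) /\ rowmotion_inv P w (rowmotion P w x) = x.
Proof.
case=> _ wP _ x0; have sw : {subset w <= P} by move=> q; rewrite wP.
by split; [exact: toggles_positive | exact: toggles_revK].
Qed.

Lemma rowmotion_invK P w x : linear_extension P w -> positive_on P x ->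
  positive_on P (rowmotion_inv P w x) /\
  rowmotion P w (rowmotion_inv P w x) = x.
Proof.
case=> _ wP _ x0; have sw : {subset rev w <= P}.
  by move=> q; rewrite mem_rev wP.
split; first exact: toggles_positive.
by rewrite -[w in rowmotion _ w]revK; exact: toggles_revK.
Qed.

End Toggles.

(* All posets live in {0,...,r+s} x {0,...,s} with the componentwise order;    *)
(* coordinates are 1-based, those equal to 0 and the column i = r+s being      *)
(* unused.                                                                     *)
Notation grid r s := ('I_(r + s).+1 *p 'I_s.+1)%type.

Section Trapezoids.
Variables r s : nat.
Implicit Types (t k : nat) (p : grid r s).

Definition pt (i j : nat) : grid r s := (inord i, inord j).

(* RT_{r,t} and T_{r,t}, for t <= s, as subsets of the grid.  The condition    *)
(* i - j < r is written i < r + j to avoid truncated subtraction.              *)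
Definition RT t : {set grid r s} :=
  [set p : grid r s | [&& (1 <= p.1 <= r + t - 1)%N, (1 <= p.2 <= t)%N &
               (p.1 < r + p.2)%N]].

Definition trap t : {set grid r s} := [set p : grid r s in RT t | (t < p.1 + p.2)%N].

(* The interval [a, b] of RT_{r,s}; the bounds are plain pairs of naturals     *)
(* because they need not belong to RT_{r,s}, e.g. a = (s, s+1).                *)
Definition RTitv (a b : nat * nat) : {set grid r s} :=
  [set p : grid r s in RT s | (a.1 <= p.1 <= b.1)%N && (a.2 <= p.2 <= b.2)%N].

Definition Iposet k : {set grid r s} :=
  trap k :|: RTitv (k, k.+1) ((r + k - 1)%N, s).

(* The left border {(l+r-1, l) : 1 <= l <= s}. *)
Definition left_border : {set grid r s} :=
  [set p : grid r s | (1 <= p.2 <= s)%N && (p.1 == p.2 + r - 1 :> nat)%N].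

Definition Mposet k : {set grid r s} := RTitv (k, 1%N) ((r + k)%N, k.+1).

Definition polygonal_chains k : {set {set grid r s}} :=
  [set C in max_chains (Iposet k) |
     (C :&: left_border != set0) || (pt k 1 \in C)].

Variable R : realType.
Implicit Type x : {ffun grid r s -> R}.

Definition polygonal_rowmotion k (w : seq (grid r s)) x :
    {ffun grid r s -> R} :=
  toggles (polygonal_chains k) w x.

Definition xbar k x : {ffun grid r s -> R} :=
  [ffun p => if p == pt k 1 then 1 else x p].

(* [w] is a linear extension of M_k.  Only the values on I_k matter; a point   *)
(* (i,j) of I_k outside M_k satisfies either j > k+1 or i < k.                 *)
Definition zeta k (w : seq (grid r s)) x : {ffun grid r s -> R} :=
  [ffun p => if p \in Mposet k then rowmotion_inv (Mposet k) w (xbar k x) p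
             else if (k.+1 < p.2)%N then x (pt p.1.+1 p.2)
             else x (pt p.1 p.2.+1)].

End Trapezoids.

(* Main.v *)
(* Toggling bottom to top turns rowmotion into bilinear equations between
   sums over chains below p of the new labels and sums over chains above p of
   the old ones: D U = 1 for antichain rowmotion, and D U - D0 U0 = 1 for
   polygonal rowmotion, where D0, U0 only count the chains that avoid the
   left border and the minimal element (k, 1).  On M_k the labels x and their
   image under inverse rowmotion both derive from one function G, by
     x p = G p / (sum of G below p),  z p = G(p)^-1 / (sum of G^-1 above p),
   and a Darboux-type transformation carries chain sums for x to chain sums
   for z, exchanging solutions that vanish on the left border with
   unconstrained ones.  Thus D U and D0 U0 trade roles, and a discrete
   harmonicity argument shows that D U - D0 U0 = 1 on I_(k+1) implies the
   same identity for the transformed quantities on I_k, whose solution is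
   unique. *)

Require Import Defs.
From mathcomp Require Import all_boot all_order all_algebra.
From mathcomp Require Import reals zify ring lra.

Set Implicit Arguments.
Unset Strict Implicit.
Unset Printing Implicit Defensive.

Import Order.TTheory GRing.Theory Num.Theory.
Local Open Scope ring_scope.

(** * Sums over maximal chains *)

Section MaxChains.
Variables (d : Order.disp_t) (T : finPOrderType d).
Implicit Types (P Q C S : {set T}) (p q : T).

(** Neither of the two products D U and D0 U0 is preserved by [zeta]; only their difference is.
    Inverse rowmotion on M_k swaps the boundary conditions: with V, V0, E, E0 the sums for the
    images, U pairs with V0, U0 with V, D with E0 and D0 with E. So the quantity to follow is the
    mixed one, D V0 - D0 V, taken across the covers of the staircase: it is 1 on horizontal covers
    and -1 on vertical ones, and these opposite signs force the defect of each unit square to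
    vanish.

    Outside M_k, [zeta] is a translation, but the sums that leave M_k are not translates of each
    other; only the differences V - V0 and E - E0 are. This suffices: left of M_k the two down sums
    coincide, above M_k the two up sums do, so that the identity there involves just one difference.

    The relations on M_k also need boundary values next to it. The empty chain beyond a minimal or
    maximal element becomes a virtual value 1 in a neighbouring cell, and this cell differs between
    full and restricted sums. *)

Definition below P p : {set T} := [set q in P | (q < p)%O].
Definition above P p : {set T} := [set q in P | (p < q)%O].

Lemma is_chainP C :
  reflect {in C &, forall p q, (p >=< q)%O} (is_chain C).
Proof.
apply: (iffP forall_inP) => [h p q pC qC|h p pC].
  exact: (forall_inP (h p pC)).
by apply/forall_inP => q qC; apply: h.
Qed.

Lemma max_chainsP P C :
  reflect [/\ C \subset P, {in C &, forall p q, (p >=< q)%O} &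
      forall q, q \in P -> {in C, forall c, (q >=< c)%O} -> q \in C]
    (C \in max_chains P).
Proof.
rewrite inE; apply: (iffP maxsetP) => /= [[/andP[sC /is_chainP cC] mC]|].
  split=> // q qP qC; rewrite -(mC (q |: C)) ?setU11 ?subsetUr //.
  rewrite subUset sub1set qP sC; apply/is_chainP => a b.
  rewrite !inE => /predU1P[->|aC] /predU1P[->|bC]; rewrite ?comparablexx //.
  - exact: qC.
  - by rewrite comparable_sym qC.
  - exact: cC.
case=> sC cC mC; split=> [|D /andP[sD /is_chainP cD] CD].
  by rewrite sC; apply/is_chainP.
apply/eqP; rewrite eqEsubset CD andbT; apply/subsetP => q qD.
apply: mC => [|c cC']; first exact: (subsetP sD).
by apply: cD => //; apply: (subsetP CD).
Qed.

Lemma max_chains_ext P C : C \subset P -> {in C &, forall p q, (p >=< q)%O} ->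
  exists2 D, D \in max_chains P & C \subset D.
Proof.
move=> sC /is_chainP cC.
have [|D mD CD] := @maxset_exists _
  [pred D : {set T} | (D \subset P) && is_chain D] C; first by rewrite /= sC.
by exists D; rewrite ?inE.
Qed.

Lemma max_chains_set0 : max_chains (set0 : {set T}) = [set set0].
Proof.
apply/setP => C; rewrite in_set1; apply/max_chainsP/eqP => [[]|->].
  by rewrite subset0 => /eqP.
by split=> [|p q|q]; rewrite ?inE ?sub0set.
Qed.

Lemma max_chains_split P p A B : p \in P ->
  A \in max_chains (below P p) -> B \in max_chains (above P p) ->
  p |: (A :|: B) \in max_chains P.
Proof.
move=> pP /max_chainsP[sA cA mA] /max_chainsP[sB cB mB].
have ltA a : a \in A -> (a < p)%O.
  by move=> /(subsetP sA); rewrite inE => /andP[].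
have ltB b : b \in B -> (p < b)%O.
  by move=> /(subsetP sB); rewrite inE => /andP[].
apply/max_chainsP; split.
- rewrite !subUset sub1set pP /=; apply/andP; split.
    by apply: (subset_trans sA); apply/subsetP => q; rewrite inE => /andP[].
  by apply: (subset_trans sB); apply/subsetP => q; rewrite inE => /andP[].
- have cp q : q \in p |: (A :|: B) -> (p >=< q)%O.
    rewrite !inE => /predU1P[->|/orP[/ltA|/ltB]]; first exact: comparablexx.
      by move/ltW; apply: ge_comparable.
    by move/ltW; apply: le_comparable.
  move=> a b; rewrite !inE.
  case/predU1P=> [->|aAB]; first by move=> h; apply: cp; rewrite !inE.
  case/predU1P=> [->|bAB].
    by rewrite comparable_sym; apply: cp; rewrite !inE aAB orbT.
  case/orP: aAB => [aA|aB]; case/orP: bAB => [bA|bB]; [exact: cA| | |exact: cB].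
    by apply/le_comparable/ltW/(lt_trans (ltA _ aA) (ltB _ bB)).
  by apply/ge_comparable/ltW/(lt_trans (ltA _ bA) (ltB _ aB)).
- move=> q qP qC.
  have := qC p; rewrite setU11 => /(_ isT).
  case/comparable_ltgtP => [lqp|lpq|->]; last exact: setU11.
    rewrite !inE mA ?orbT // ?inE ?qP // => c cA'.
    by apply: qC; rewrite !inE cA' orbT.
  rewrite !inE mB ?orbT // ?inE ?qP // => c cB'.
  by apply: qC; rewrite !inE cB' !orbT.
Qed.

Lemma below_max_chain P p C : C \in max_chains P -> p \in C ->
  C :&: [set q | (q < p)%O] \in max_chains (below P p).
Proof.
move=> /max_chainsP[sC cC mC] pC; apply/max_chainsP; split.
- apply/subsetP => q; rewrite !inE => /andP[qC ->].
  by rewrite (subsetP sC).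
- by move=> a b; rewrite !inE => /andP[aC _] /andP[bC _]; apply: cC.
- move=> q; rewrite !inE => /andP[qP lqp] qC; rewrite lqp andbT.
  apply: mC => // c cC'; have [lcp|lpc|->] := comparable_ltgtP (cC _ _ cC' pC).
  + by apply: qC; rewrite !inE cC'.
  + by apply/le_comparable/ltW/(lt_trans lqp).
  + exact/le_comparable/ltW.
Qed.

Lemma above_max_chain P p C : C \in max_chains P -> p \in C ->
  C :&: [set q | (p < q)%O] \in max_chains (above P p).
Proof.
move=> /max_chainsP[sC cC mC] pC; apply/max_chainsP; split.
- apply/subsetP => q; rewrite !inE => /andP[qC ->].
  by rewrite (subsetP sC).
- by move=> a b; rewrite !inE => /andP[aC _] /andP[bC _]; apply: cC.
- move=> q; rewrite !inE => /andP[qP lpq] qC; rewrite lpq andbT.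
  apply: mC => // c cC'; have [lcp|lpc|->] := comparable_ltgtP (cC _ _ cC' pC).
  + by apply/ge_comparable/ltW/(lt_trans lcp).
  + by apply: qC; rewrite !inE cC'.
  + exact/ge_comparable/ltW.
Qed.

Lemma max_chain_splitE P p C : C \in max_chains P -> p \in C ->
  p |: (C :&: [set q | (q < p)%O] :|: C :&: [set q | (p < q)%O]) = C.
Proof.
move=> /max_chainsP[_ cC _] pC; apply/setP => q; rewrite !inE.
case: eqP => [->|/eqP qp] /=; first by rewrite pC.
have [qC|//] := boolP (q \in C).
by case: (comparable_ltgtP (cC _ _ qC pC)) qp => // ->; rewrite eqxx.
Qed.

Lemma max_chain_min Q C : C \in max_chains Q -> Q != set0 ->
  exists2 q, q \in C & below Q q = set0.
Proof.
move=> /max_chainsP[sC cC mC] /set0Pn[q0 q0Q].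
have [c0 c0C] : exists c, c \in C.
  apply/set0Pn/eqP => C0; have: q0 \in C by apply: mC => // c; rewrite C0 inE.
  by rewrite C0 inE.
have [q qC qmin] := arg_minnP (fun c => #|below Q c|) c0C.
exists q => //; apply/eqP; rewrite -subset0; apply/subsetP => a.
rewrite inE => /andP[aQ aq].
have sub b : b \in Q -> (b < q)%O -> (#|below Q b| < #|below Q q|)%N.
  move=> bQ bq; apply: proper_card; apply/properP; split.
    by apply/subsetP => e; rewrite !inE => /andP[-> /lt_trans -> //].
  by exists b; rewrite !inE ?bQ // ltxx andbF.
have qle c : c \in C -> (q <= c)%O.
  move=> cC'; have [cq|//|//] := comparable_ltgtP (cC _ _ cC' qC).
  by have := sub _ (subsetP sC _ cC') cq; rewrite ltnNge qmin.
have: a \in C.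
  apply: mC => // c /qle qc; apply/le_comparable/ltW.
  exact: lt_le_trans aq qc.
by move=> /qmin; rewrite leqNgt sub.
Qed.

Lemma max_chain_max Q C : C \in max_chains Q -> Q != set0 ->
  exists2 q, q \in C & above Q q = set0.
Proof.
move=> /max_chainsP[sC cC mC] /set0Pn[q0 q0Q].
have [c0 c0C] : exists c, c \in C.
  apply/set0Pn/eqP => C0; have: q0 \in C by apply: mC => // c; rewrite C0 inE.
  by rewrite C0 inE.
have [q qC qmin] := arg_minnP (fun c => #|above Q c|) c0C.
exists q => //; apply/eqP; rewrite -subset0; apply/subsetP => a.
rewrite inE => /andP[aQ aq].
have sub b : b \in Q -> (q < b)%O -> (#|above Q b| < #|above Q q|)%N.
  move=> bQ bq; apply: proper_card; apply/properP; split.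
    by apply/subsetP => e; rewrite !inE => /andP[-> /(lt_trans bq) ->].
  by exists b; rewrite !inE ?bQ // ltxx andbF.
have qge c : c \in C -> (c <= q)%O.
  move=> cC'; have [//|qc|//] := comparable_ltgtP (cC _ _ cC' qC).
  by have := sub _ (subsetP sC _ cC') qc; rewrite ltnNge qmin.
have: a \in C.
  apply: mC => // c /qge qc; apply/ge_comparable/ltW.
  exact: le_lt_trans qc aq.
by move=> /qmin; rewrite leqNgt sub.
Qed.

Section Sums.
Variable R : comNzRingType.
Implicit Types f g : T -> R.

Definition chain_sum f Q : R := \sum_(C in max_chains Q) \prod_(c in C) f c.

Definition up_sum P f p : R := f p * chain_sum f (above P p).
Definition down_sum P f p : R := f p * chain_sum f (below P p).

Lemma eq_chain_sum f g Q : {in Q, f =1 g} -> chain_sum f Q = chain_sum g Q.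
Proof.
move=> fg; apply: eq_bigr => C /max_chainsS/subsetP sC.
by apply: eq_bigr => c /sC /fg.
Qed.

Lemma chain_sum_set0 f : chain_sum f set0 = 1.
Proof. by rewrite /chain_sum max_chains_set0 big_set1 big_set0. Qed.

(** The parts of a maximal chain below and above p range independently over the maximal chains of
    the two induced subposets. *)
Lemma chain_sum_through P f p : p \in P ->
  \sum_(C in max_chains P | p \in C) \prod_(c in C) f c =
  f p * chain_sum f (below P p) * chain_sum f (above P p).
Proof.
move=> pP; rewrite -mulrA /chain_sum big_distrlr /= mulr_sumr.
under [RHS]eq_bigr do rewrite mulr_sumr.
rewrite pair_big_dep /=.
pose h (X : {set T} * {set T}) := p |: (X.1 :|: X.2).
pose h' C := (C :&: [set q | (q < p)%O], C :&: [set q | (p < q)%O]).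
rewrite (reindex_onto h h') /=; last first.
  by move=> C /andP[CM pC]; exact: (max_chain_splitE CM pC).
have hK (A B : {set T}) : A \subset below P p -> B \subset above P p ->
    h' (h (A, B)) = (A, B).
  move=> /subsetP sA /subsetP sB; congr (_, _); apply/setP => q; rewrite !inE.
    case: eqP => [->|_] /=.
      by rewrite ltxx; apply/esym/negP => /sA; rewrite inE ltxx andbF.
    apply/andP/idP => [[/orP[//|/sB]]|qA].
      by rewrite inE => /andP[_ l1] l2; have := lt_trans l1 l2; rewrite ltxx.
    by rewrite qA; split=> //; move: (sA _ qA); rewrite inE => /andP[].
  case: eqP => [->|_] /=.
    by rewrite ltxx; apply/esym/negP => /sB; rewrite inE ltxx andbF.
  apply/andP/idP => [[/orP[/sA|//]]|qB].
    by rewrite inE => /andP[_ l1] l2; have := lt_trans l1 l2; rewrite ltxx.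
  by rewrite qB orbT; split=> //; move: (sB _ qB); rewrite inE => /andP[].
apply: eq_big => [[A B]|[A B] /andP[/andP[CM _] /eqP E]].
  apply/idP/idP => [/andP[/andP[CM pC] /eqP E]|/andP[AM BM]] /=.
    have := below_max_chain CM pC; have := above_max_chain CM pC.
    by move: E; rewrite /h' => -[-> ->] -> ->.
  rewrite hK ?max_chainsS // eqxx andbT /h /= setU11 andbT.
  exact: max_chains_split.
have pC : p \in h (A, B) by apply: setU11.
have := max_chainsS (below_max_chain CM pC).
have := max_chainsS (above_max_chain CM pC).
move: (E); rewrite /h' => -[-> ->] /subsetP sB /subsetP sA.
rewrite /h /= big_setU1; last first.
  by rewrite inE; apply/negP => /orP[/sA|/sB]; rewrite inE ltxx andbF.
congr (_ * _); rewrite [LHS](big_setID A) /=; congr (_ * _).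
  by apply: eq_bigl => q; rewrite !inE; case: (q \in A); rewrite ?andbT ?andbF.
apply: eq_bigl => q; rewrite !inE; case: (boolP (q \in B)) => [qB|_].
  rewrite orbT andbT; apply/negP => /sA; move: (sB _ qB); rewrite !inE.
  by move=> /andP[_ l1] /andP[_ l2]; have := lt_trans l1 l2; rewrite ltxx.
by rewrite orbF andNb.
Qed.

(** Each maximal chain of a nonempty poset contains exactly one minimal element of the poset, which
    groups the chains. *)
Lemma chain_sum_min f Q : Q != set0 ->
  chain_sum f Q = \sum_(q in Q | below Q q == set0) up_sum Q f q.
Proof.
move=> Q0; under eq_bigr => q /andP[qQ /eqP q0].
  rewrite /up_sum -[f q]mulr1 -(chain_sum_set0 f) -q0 -chain_sum_through //.
  over.
rewrite (exchange_big_dep (mem (max_chains Q))) /=; last first.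
  by move=> ? ? _ /andP[].
apply: eq_bigr => C CM; have [sC cC mC] := max_chainsP _ _ CM.
have [q qC qmin] := max_chain_min CM Q0.
have qQ := subsetP sC _ qC.
rewrite [RHS](big_pred1 q) // => p /=; rewrite CM /=.
apply/andP/eqP => [[/andP[pQ /eqP p0] pC]|->]; last by rewrite qQ qmin qC eqxx.
have [l|l|//] := comparable_ltgtP (cC _ _ pC qC).
  by have: p \in below Q q; [rewrite inE pQ | rewrite qmin inE].
by have: q \in below Q p; [rewrite inE qQ | rewrite p0 inE].
Qed.

Lemma chain_sum_max f Q : Q != set0 ->
  chain_sum f Q = \sum_(q in Q | above Q q == set0) down_sum Q f q.
Proof.
move=> Q0; under eq_bigr => q /andP[qQ /eqP q0].
  rewrite /down_sum -[_ * _]mulr1 -(chain_sum_set0 f) -q0 -chain_sum_through //.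
  over.
rewrite (exchange_big_dep (mem (max_chains Q))) /=; last first.
  by move=> ? ? _ /andP[].
apply: eq_bigr => C CM; have [sC cC mC] := max_chainsP _ _ CM.
have [q qC qmax] := max_chain_max CM Q0.
have qQ := subsetP sC _ qC.
rewrite [RHS](big_pred1 q) // => p /=; rewrite CM /=.
apply/andP/eqP => [[/andP[pQ /eqP p0] pC]|->]; last by rewrite qQ qmax qC eqxx.
have [l|l|//] := comparable_ltgtP (cC _ _ pC qC).
  by have: q \in above Q p; [rewrite inE qQ | rewrite p0 inE].
by have: p \in above Q q; [rewrite inE pQ | rewrite qmax inE].
Qed.

(** Chains going up from p are grouped by the cover of p that they visit next. *)
Lemma up_sum_rec P f p : above P p != set0 ->
  up_sum P f p =
  f p * \sum_(q in above P p | below (above P p) q == set0) up_sum P f q.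
Proof.
move=> /(chain_sum_min f) E; rewrite /up_sum E; congr (_ * _).
apply: eq_bigr => q /andP[]; rewrite inE => /andP[_ pq] _.
rewrite /up_sum; congr (_ * chain_sum _ _); apply/setP => a; rewrite !inE.
by case: (boolP (q < a)%O) => [/(lt_trans pq) ->|]; rewrite ?andbT ?andbF.
Qed.

Lemma down_sum_rec P f p : below P p != set0 ->
  down_sum P f p =
  f p * \sum_(q in below P p | above (below P p) q == set0) down_sum P f q.
Proof.
move=> /(chain_sum_max f) E; rewrite /down_sum E; congr (_ * _).
apply: eq_bigr => q /andP[]; rewrite inE => /andP[_ qp] _.
rewrite /down_sum; congr (_ * chain_sum _ _); apply/setP => a; rewrite !inE.
case: (boolP (a < q)%O) => [l|]; rewrite ?andbT ?andbF //.
by rewrite (lt_trans l qp) andbT.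
Qed.

Lemma up_sum_maximal P f p : above P p = set0 -> up_sum P f p = f p.
Proof. by rewrite /up_sum => ->; rewrite chain_sum_set0 mulr1. Qed.

Lemma down_sum_minimal P f p : below P p = set0 -> down_sum P f p = f p.
Proof. by rewrite /down_sum => ->; rewrite chain_sum_set0 mulr1. Qed.

End Sums.
End MaxChains.

(** * Toggling along a linear extension *)

Section ToggleSystems.
Variables (R : realType) (d : Order.disp_t) (T : finPOrderType d).
Implicit Types (P C S : {set T}) (F : {set {set T}}) (p q : T) (w : seq T).
Implicit Types x y : {ffun T -> R}.

(** The labeling seen at the moment when p is toggled: new labels f strictly below p, old labels g
    at p and above. *)
Definition mix (p : T) (f g : T -> R) : T -> R :=
  fun c => if (c < p)%O then f c else g c.

Definition erase S (f : T -> R) : T -> R := fun c => if c \in S then 0 else f c.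

Definition meeting P S : {set {set T}} :=
  [set C in max_chains P | C :&: S != set0].

Lemma meeting_max P S C : C \in meeting P S -> C \in max_chains P.
Proof. by rewrite inE => /andP[]. Qed.

Lemma toggles_notin F w x q : q \notin w -> toggles F w x q = x q.
Proof.
elim: w x => //= p w IH x; rewrite inE negb_or => /andP[qp qw].
by rewrite /toggles /= -/(toggles _ _ _) IH // ffunE (negPf qp).
Qed.

(** All elements of a chain through p are comparable to p, so the linear extension decides which of
    them have been toggled before p. *)
Lemma togglesE F P w x p : linear_extension P w ->
  {in F, forall C, C \in max_chains P} -> p \in P ->
  toggles F w x p =
  (\sum_(C in F | p \in C) \prod_(c in C) mix p (toggles F w x) x c)^-1.
Proof.
move=> [uw wP lw] FM pP.
have pw : p \in w by rewrite wP.
have lt_index c : c \in P ->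
    (index c w < index p w)%N = (c \in take (index p w) w).
  by move=> cP; rewrite in_take ?wP.
have Ew : w = take (index p w) w ++ p :: drop (index p w).+1 w.
  rewrite -{1}(cat_take_drop (index p w) w) (drop_nth p) ?index_mem //.
  by rewrite nth_index.
set w1 := take _ w in Ew lt_index; set w2 := drop _ w in Ew.
have un : uniq (w1 ++ p :: w2) by rewrite -Ew.
move: un; rewrite cat_uniq => /and3P[_ hd /andP[pw2 _]].
set x1 := toggles F w1 x.
have Et : toggles F w x = toggles F w2 (toggle F p x1).
  by rewrite {1}Ew /toggles foldl_cat.
rewrite {1}Et toggles_notin // ffunE eqxx; congr (_^-1).
apply: eq_bigr => C /andP[CF pC]; apply: eq_bigr => c cC.
have /max_chainsP[sC cM _] := FM _ CF.
have cP := subsetP sC _ cC.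
rewrite /mix; case: ifPn => [cp|ncp].
  have cw1 : c \in w1 by rewrite -lt_index // lw.
  have : c \notin p :: w2.
    by apply: contra hd => h; apply/hasP; exists c.
  rewrite inE negb_or => /andP[cnp cw2].
  by rewrite Et toggles_notin // ffunE (negPf cnp).
rewrite /x1 toggles_notin // -lt_index // -leqNgt.
have [cp|pc|->//] := comparable_ltgtP (cM _ _ cC pC).
  by rewrite cp in ncp.
by apply/ltnW/lw.
Qed.

(** The equation at p involves y only strictly below p on its right side, so induction along the
    list determines y. *)
Lemma toggles_unique F P w x (y : T -> R) : linear_extension P w ->
  {in F, forall C, C \in max_chains P} ->
  {in P, forall p, y p =
     (\sum_(C in F | p \in C) \prod_(c in C) mix p y x c)^-1} ->
  {in P, toggles F w x =1 y}.
Proof.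
move=> lw FM yE p; move: {2}(index p w).+1 (ltnSn (index p w)) => n.
elim: n p => // n IH p; rewrite ltnS => pn pP.
rewrite (togglesE _ lw) // yE //; congr (_^-1).
apply: eq_bigr => C /andP[CF pC]; apply: eq_bigr => c cC.
rewrite /mix; case: ifP => // cp; have [_ _ lt] := lw.
have cP : c \in P by apply: subsetP cC; apply/max_chainsS/FM.
by apply: IH => //; apply: leq_trans pn; apply: lt.
Qed.

Lemma sum_mix P f g p : p \in P ->
  \sum_(C in max_chains P | p \in C) \prod_(c in C) mix p f g c =
  chain_sum f (below P p) * up_sum P g p.
Proof.
move=> pP; rewrite chain_sum_through // {1}/mix ltxx [X in X * _]mulrC -mulrA.
congr (_ * (_ * _)); apply: eq_chain_sum => q; rewrite inE => /andP[_].
  by rewrite /mix => ->.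
by rewrite /mix => /lt_gtF ->.
Qed.

(** Erasure kills the product of every chain that meets S and leaves the others intact. *)
Lemma sum_meeting P S (f : T -> R) p :
  \sum_(C in meeting P S | p \in C) \prod_(c in C) f c =
  \sum_(C in max_chains P | p \in C) \prod_(c in C) f c -
  \sum_(C in max_chains P | p \in C) \prod_(c in C) erase S f c.
Proof.
rewrite [X in X - _](bigID (fun C => C :&: S != set0)) /=.
rewrite [X in _ - X](bigID (fun C => C :&: S != set0)) /=.
rewrite [X in _ - (X + _)]big1 ?add0r; last first.
  move=> C /andP[_ /set0Pn[c]]; rewrite inE => /andP[cC cS].
  by rewrite (bigD1 c) //= /erase cS mul0r.
rewrite [X in _ + X - _](_ : _ =
    \sum_(C in max_chains P | (p \in C) && ~~ (C :&: S != set0))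
    \prod_(c in C) erase S f c); last first.
  apply: eq_big => [C|C /andP[_ /negPn/eqP CS]]; first by rewrite andbA.
  apply: eq_bigr => c cC; rewrite /erase; case: ifP => // cS.
  by have: c \in C :&: S; [rewrite inE cC | rewrite CS inE].
rewrite [X in _ - X](eq_bigl _ _ (fun C => esym (andbA _ _ _))) addrK.
by apply: eq_bigl => C; rewrite inE -!andbA; congr (_ && _); rewrite andbC.
Qed.

Lemma erase_mix S (f g : T -> R) p c :
  erase S (mix p f g) c = mix p (erase S f) (erase S g) c.
Proof. by rewrite /erase /mix; case: ifP => //; case: ifP. Qed.

(* All maximal chains minus those avoiding S: this is 1 at every p iff f is
   the result of toggling g along the chains meeting S. *)
Definition polygon_form P S f g p : R :=
  down_sum P f p * up_sum P g p -
  down_sum P (erase S f) p * up_sum P (erase S g) p.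

Lemma polygon_formE P S f g p : p \in P ->
  polygon_form P S f g p =
  f p * \sum_(C in meeting P S | p \in C) \prod_(c in C) mix p f g c.
Proof.
move=> pP; rewrite sum_meeting mulrBr sum_mix // mulrA; congr (_ - _).
rewrite [X in _ = f p * X](_ : _ = \sum_(C in max_chains P | p \in C)
    \prod_(c in C) mix p (erase S f) (erase S g) c); last first.
  by apply: eq_bigr => C _; apply: eq_bigr => c _; exact: erase_mix.
(* One side erases both f and g at p, the other only g; if p lies in S both are 0, and otherwise
   nothing is erased at p. *)
have erasep h : erase S h p = if p \in S then 0 else h p by [].
rewrite sum_mix // mulrA /down_sum /up_sum !erasep.
by case: ifP => _; rewrite ?(mul0r, mulr0).
Qed.

Lemma toggles_polygon P S w x : linear_extension P w ->
  {in P, forall p, toggles (meeting P S) w x p != 0} ->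
  {in P, forall p, polygon_form P S (toggles (meeting P S) w x) x p = 1}.
Proof.
move=> lw y0 p pP; rewrite polygon_formE //.
have := y0 p pP; rewrite (togglesE _ lw) //; last exact: meeting_max.
by rewrite invr_eq0 => /mulVf.
Qed.

Lemma polygon_toggles P S w x (y : T -> R) : linear_extension P w ->
  {in P, forall p, polygon_form P S y x p = 1} ->
  {in P, toggles (meeting P S) w x =1 y}.
Proof.
move=> lw yE; apply: toggles_unique lw _ _ => [C|p pP].
  exact: meeting_max.
by have := yE p pP; rewrite polygon_formE // -[X in _ * X]invrK => /divr1_eq.
Qed.

Lemma toggles_down_up P w x : linear_extension P w ->
  {in P, forall p, toggles (max_chains P) w x p != 0} ->
  {in P, forall p,
    down_sum P (toggles (max_chains P) w x) p * up_sum P x p = 1}.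
Proof.
move=> lw y0 p pP; rewrite /down_sum -mulrA -sum_mix //.
have := y0 p pP; rewrite (togglesE _ lw) //.
by rewrite invr_eq0 => /mulVf.
Qed.

Lemma toggle_meeting_positive P S p x : p \in P ->
  (exists2 C, C \in meeting P S & p \in C) ->
  positive_on P x -> positive_on P (toggle (meeting P S) p x).
Proof.
move=> pP [C CM pC] x0 q qP; rewrite ffunE; case: eqP => _; last exact: x0.
have gt0 D : D \in meeting P S -> 0 < \prod_(c in D) x c.
  move=> /meeting_max/max_chainsS/subsetP sD; apply: prodr_gt0 => c cD.
  exact: x0 (sD _ cD).
rewrite invr_gt0 (bigD1 C) /=; last by rewrite CM.
rewrite ltr_wpDr ?gt0 //; apply: sumr_ge0 => D /andP[/andP[DM _] _].
exact/ltW/gt0.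
Qed.

Lemma toggles_meeting_positive P S w x : {subset w <= P} ->
  {in P, forall p, exists2 C, C \in meeting P S & p \in C} ->
  positive_on P x -> positive_on P (toggles (meeting P S) w x).
Proof.
move=> + PS; elim: w x => //= p w IH x sw x0; apply: IH => [q qw|].
  by apply: sw; rewrite inE qw orbT.
have pP : p \in P by apply: sw; rewrite inE eqxx.
by apply: toggle_meeting_positive => //; apply: PS.
Qed.

(** Serves positivity: it provides a nonempty sum in the toggle at p. *)
Lemma comparable_meeting P S p q : p \in P -> q \in P -> q \in S ->
  (p >=< q)%O -> exists2 C, C \in meeting P S & p \in C.
Proof.
move=> pP qP qS pq.
have [||C CM] := @max_chains_ext _ _ P [set p; q].
- by rewrite subUset !sub1set pP.
- by move=> a b /set2P[]-> /set2P[]->; rewrite ?comparablexx // comparable_sym.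
rewrite subUset !sub1set => /andP[pC qC]; exists C => //.
by rewrite inE CM; apply/set0Pn; exists q; rewrite inE qC.
Qed.

End ToggleSystems.

Section Positivity.
Variables (F : realFieldType) (d : Order.disp_t) (T : finPOrderType d).
Implicit Types (P L : {set T}) (f g : T -> F) (p q : T).

Lemma chain_sum_gt0 P f : {in P, forall p, 0 < f p} -> 0 < chain_sum f P.
Proof.
move=> f0; have gt0 C : C \in max_chains P -> 0 < \prod_(c in C) f c.
  by move=> /max_chainsS/subsetP sC; apply: prodr_gt0 => c /sC /f0.
have [||C CM _] := @max_chains_ext _ _ P set0; first exact: sub0set.
  by move=> p q; rewrite inE.
rewrite /chain_sum (bigD1 C) //= ltr_wpDr ?gt0 //.
by apply: sumr_ge0 => D /andP[/gt0/ltW].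
Qed.

Lemma down_sum_gt0 P f p : {in P, forall q, 0 < f q} -> p \in P ->
  0 < down_sum P f p.
Proof.
move=> f0 pP; rewrite mulr_gt0 ?f0 //; apply: chain_sum_gt0 => q.
by rewrite inE => /andP[/f0].
Qed.

Lemma eq_up_sum P f g p : p \in P ->
  {in P, forall q, (p <= q)%O -> f q = g q} -> up_sum P f p = up_sum P g p.
Proof.
move=> pP fg; rewrite /up_sum fg //; congr (_ * _); apply: eq_chain_sum => q.
by rewrite inE => /andP[qP /ltW]; apply: fg.
Qed.

End Positivity.

(** * The pairing identity on a staircase *)

Section Staircase.
Variables (F : realFieldType) (m n : nat).
Hypotheses (m_gt0 : (0 < m)%N) (n_gt0 : (0 < n)%N).
Implicit Types (a b : nat) (D E G H U V : nat -> nat -> F).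

(* The shape of M_k, with a = i - k + 1, b = j, m = r - k and n = k + 1; its
   wall a = m + b is the left border. *)
Definition stair a b : bool := [&& 0 < a, a <= m + b, 0 < b & b <= n]%N.

Definition stair_weight G : Prop :=
  (forall a b, stair a b -> 0 < G a b) /\
  (forall a b, stair a b = false -> G a b = 0).

Lemma stair_weight_gt0 G a b : stair_weight G -> stair a b -> 0 < G a b.
Proof. by move=> [+ _]; apply. Qed.

Lemma stair_weight_eq0 G a b : stair_weight G -> stair a b = false -> G a b = 0.
Proof. by move=> [_ +]; apply. Qed.

(* For the label x p = G p / (sum of G over the elements covered by p), this
   is the recursion of sums of x over chains going up from p; on the wall it
   is kept when [free] and replaced by vanishing otherwise. *)
Definition up_eq (free : bool) G U : Prop :=
  (forall a b, stair a.+1 b.+1 -> (0 < a + b)%N -> free || (a < m + b)%N ->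
    U a.+1 b.+1 * (G a b.+1 + G a.+1 b) =
    G a.+1 b.+1 * (U a.+2 b.+1 + U a.+1 b.+2)) /\
  (forall b, (0 < b)%N -> (b <= n)%N ->
    U (m + b).+1 b = 0 /\ (~~ free -> U (m + b)%N b = 0)).

(* The same for the label z p = G(p)^-1 / (sum of G^-1 over the covers of p),
   which is the image of x under inverse rowmotion; G^-1 = 0 outside the
   staircase since 0^-1 = 0. *)
Definition up_dual_eq (free : bool) G V : Prop :=
  (forall a b, stair a b -> (a + b < m + n + n)%N -> free || (a < m + b)%N ->
    V a b * ((G a.+1 b)^-1 + (G a b.+1)^-1) =
    (G a b)^-1 * (V a.+1 b + V a b.+1)) /\
  V (m + n)%N n = 0 /\
  (forall b, (0 < b)%N -> (b <= n)%N ->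
    V (m + b).+1 b = 0 /\ (~~ free -> V (m + b)%N b = 0)).

(** The given increments add up to vb B - va A = t (u1 + u2) = (A + B) ut, and the equation for vp
    says that vp P splits this change in the ratio A : B. *)
Lemma square_up (A B P t va vb vt vp ut u1 u2 : F) :
  0 < A -> 0 < B -> 0 < P ->
  vp * (A^-1 + B^-1) = P^-1 * (va + vb) ->
  ut * (B + A) = t * (u1 + u2) ->
  vt * t - va * A = t * u1 -> vb * B - vt * t = t * u2 ->
  vp * P - va * A = A * ut /\ vb * B - vp * P = B * ut.
Proof.
move=> A0 B0 P0 hV hU h1 h2.
have AB0 : A + B != 0 by rewrite gt_eqF // addr_gt0.
have hV' : vp * P * (A + B) = (va + vb) * A * B.
  have -> : vp * P * (A + B) = vp * (A^-1 + B^-1) * P * A * B.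
    by field; rewrite !gt_eqF.
  by rewrite hV; field; rewrite !gt_eqF.
have E : vp * P - va * A = A * ut.
  apply: (mulIf AB0).
  have : A * (vb * B - va * A) = A * (ut * (B + A)) by congr (_ * _); lra.
  lra.
by split=> //; lra.
Qed.

(* V G is a stream function of the conserved flow G U, so a solution of one
   system vanishing on the wall gives a free solution of the other. *)
Lemma up_dualP free G U V : stair_weight G -> up_eq free G U ->
  up_dual_eq (~~ free) G V ->
  (forall a, (0 < a)%N -> (a < m + n)%N -> V a n.+1 = U a.+1 n.+1) ->
  forall b, (0 < b)%N -> (b <= n)%N ->
    (forall a, (0 < a)%N -> (a < m + b)%N ->
       V a b * G a b - V a.+1 b * G a.+1 b = G a.+1 b * U a.+1 b.+1) /\
    ((b < n)%N -> forall a, (0 < a)%N -> (a <= m + b)%N ->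
       V a b.+1 * G a b.+1 - V a b * G a b = G a b.+1 * U a.+1 b.+1).
Proof.
move=> sG [hU hUw] [hV [hVm hVw]] htop b b0 bn.
move: {2}(n - b)%N (erefl (n - b)%N) => c.
(* Rows are treated from the top down, and within a row the squares from the wall towards a = 1. *)
elim: c b b0 bn => [|c IH] b b0 bn nb.
  have {nb} bE : b = n by lia.
  subst b; split=> [a a0 ab|]; last by rewrite ltnn.
  have Sp : stair a n by rewrite /stair; lia.
  have Sa : stair a.+1 n by rewrite /stair; lia.
  (* Above the top row [G] vanishes, so a single inverse weight remains, and [htop] supplies the
     neighbour of V. *)
  have := hV a n Sp; rewrite htop //.
  rewrite (stair_weight_eq0 (b := n.+1) sG); last first.
    by rewrite /stair; lia.
  rewrite invr0 addr0 => /(_ _ _) h.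
  have {}h := h ltac:(lia) ltac:(lia).
  have gp := stair_weight_gt0 sG Sp; have ga := stair_weight_gt0 sG Sa.
  have : V a n * G a n = G a.+1 n * (V a.+1 n + U a.+1 n.+1).
    have -> : V a n * G a n = V a n * (G a.+1 n)^-1 * G a n * G a.+1 n.
      by field; rewrite gt_eqF.
    by rewrite h; field; rewrite gt_eqF.
  lra.
have bn' : (b < n)%N by lia.
have [IH1 _] := IH b.+1 isT bn' ltac:(lia).
(* The edge starting at the wall belongs to no square. If U vanishes on the wall, the equation of V
   gives it; otherwise V vanishes there and the equation of U does. *)
have IHw : V (m + b)%N b.+1 * G (m + b)%N b.+1 - V (m + b)%N b * G (m + b)%N b
    = G (m + b)%N b.+1 * U (m + b).+1 b.+1.
  have Sp : stair (m + b) b by rewrite /stair; lia.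
  have Sb : stair (m + b) b.+1 by rewrite /stair; lia.
  have St : stair (m + b).+1 b.+1 by rewrite /stair; lia.
  have gp := stair_weight_gt0 sG Sp; have gb := stair_weight_gt0 sG Sb.
  have ga : G (m + b).+1 b = 0.
    by apply: stair_weight_eq0; rewrite // /stair; lia.
  have [va vw] := hVw b b0 bn.
  have [ua uw] := hUw b.+1 isT bn'.
  have [_ vw'] := hVw b.+1 isT bn'.
  case: (free) hU hV vw vw' uw {IH}; last first.
    move=> _ hV _ _ uw; rewrite -[(m + b).+1]addnS uw // mulr0.
    have := hV _ _ Sp; rewrite ga invr0 add0r va add0r.
    move=> /(_ _ _) h; have {}h := h ltac:(lia) isT.
    apply/eqP; rewrite subr_eq0; apply/eqP.
    have -> : V (m + b)%N b * G (m + b)%N b =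
       V (m + b)%N b * (G (m + b)%N b.+1)^-1 * G (m + b)%N b.+1 * G (m + b)%N b.
      by field; rewrite gt_eqF.
    by rewrite h; field; rewrite gt_eqF.
  move=> hU _ vw vw' _; rewrite vw // mul0r subr0.
  have h1 := IH1 (m + b)%N ltac:(lia) ltac:(lia).
  have := hU (m + b)%N b St ltac:(lia) isT.
  rewrite ga addr0; rewrite addnS in ua vw'; rewrite ua add0r => {}hU.
  by rewrite vw' // mul0r subr0 in h1; rewrite h1 -hU mulrC.
have main e a : (a + e = m + b)%N -> (0 < a)%N ->
  (0 < e)%N ->
  V a.+1 b.+1 * G a.+1 b.+1 - V a.+1 b * G a.+1 b = G a.+1 b.+1 * U a.+2 b.+1 ->
  V a b * G a b - V a.+1 b * G a.+1 b = G a.+1 b * U a.+1 b.+1 /\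
  V a b.+1 * G a b.+1 - V a b * G a b = G a b.+1 * U a.+1 b.+1.
  move=> ae a0 e0 h.
  have Sp : stair a b by rewrite /stair; lia.
  have Sa : stair a.+1 b by rewrite /stair; lia.
  have Sb : stair a b.+1 by rewrite /stair; lia.
  have St : stair a.+1 b.+1 by rewrite /stair; lia.
  apply: square_up (stair_weight_gt0 sG Sa) (stair_weight_gt0 sG Sb)
    (stair_weight_gt0 sG Sp) _ _ h (IH1 a a0 _); last lia.
    by apply: hV => //; lia.
  by apply: hU => //; lia.
have e2 e a : (a + e = m + b)%N -> (0 < a)%N ->
    V a b.+1 * G a b.+1 - V a b * G a b = G a b.+1 * U a.+1 b.+1.
  elim: e a => [|e IHe] a ae a0; first by have -> : a = (m + b)%N by lia.
  by have [] := main e.+1 a ae a0 isT (IHe a.+1 ltac:(lia) isT).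
split=> [a a0 ab|_ a a0 ab]; last by apply: (e2 (m + b - a)%N); lia.
have E := e2 (m + b - a.+1)%N a.+1 ltac:(lia) isT.
by have [] := main (m + b - a)%N a ltac:(lia) a0 ltac:(lia) E.
Qed.

(** The counterpart of [up_eq] for chains going down. The values at a = 0 stay open, because chains
    enter M_k from the columns to its left; restricted sums vanish also at the corner (1, 1). *)
Definition down_eq (free : bool) H D : Prop :=
  (forall a b, stair a.+1 b.+1 -> (0 < a + b)%N -> free || (a < m + b)%N ->
    D a.+1 b.+1 * (H a b.+1 + H a.+1 b) =
    H a.+1 b.+1 * (D a b.+1 + D a.+1 b)) /\
  (forall a, D a 0%N = 0) /\
  (~~ free -> D 1%N 1%N = 0) /\
  (forall b, (0 < b)%N -> (b <= n)%N ->
    D (m + b).+1 b = 0 /\ (~~ free -> D (m + b)%N b = 0)).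

Definition down_dual_eq (free : bool) H E : Prop :=
  (forall a b, stair a.+1 b.+1 -> (a.+1 + b.+1 < m + n + n)%N ->
    free || (a < m + b)%N ->
    E a.+1 b.+1 * ((H a.+2 b.+1)^-1 + (H a.+1 b.+2)^-1) =
    (H a.+1 b.+1)^-1 * (E a b.+1 + E a.+1 b)) /\
  (forall a, E a 0%N = 0) /\
  (forall b, (0 < b)%N -> (b <= n)%N ->
    E (m + b).+1 b = 0 /\ (~~ free -> E (m + b)%N b = 0)).

(** The recursion of D makes dt / t the mean of db / B and da / A with weights B and A; that of E
    turns their difference into ep (A^-1 + B^-1). *)
Lemma square_down (A B P t da db dt ep e1 e2 dp : F) :
  0 < A -> 0 < B -> 0 < P -> 0 < t ->
  ep * (A^-1 + B^-1) = P^-1 * (e1 + e2) ->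
  dt * (B + A) = t * (db + da) ->
  db / B - dp / P = e1 / P -> dp / P - da / A = e2 / P ->
  db / B - dt / t = ep / B /\ dt / t - da / A = ep / A.
Proof.
move=> A0 B0 P0 t0 hE hD h1 h2.
have AB0 : A^-1 + B^-1 != 0 by rewrite gt_eqF // addr_gt0 ?invr_gt0.
have hs : db / B - da / A = ep * (A^-1 + B^-1) by rewrite hE; lra.
have hD' : dt / t * (A^-1 + B^-1) = db / B / A + da / A / B.
  have -> : dt / t * (A^-1 + B^-1) = dt * (B + A) / t / A / B.
    by field; rewrite !gt_eqF.
  by rewrite hD; field; rewrite !gt_eqF.
have E : db / B - dt / t = ep / B.
  apply: (mulIf AB0); rewrite mulrBl hD'.
  have -> : ep / B * (A^-1 + B^-1) = (db / B - da / A) / B by rewrite hs; lra.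
  lra.
by split=> //; lra.
Qed.

(* E is the discrete derivative of D / H. *)
Lemma down_dualP free H D E : stair_weight H -> down_eq free H D ->
  down_dual_eq (~~ free) H E ->
  (forall b, (0 < b)%N -> (b < n)%N -> E 0%N b = D 0%N b.+1) ->
  forall b, (b < n)%N ->
    (forall a, (0 < a)%N -> (a <= m + b)%N ->
       D a b.+1 / H a b.+1 - D a.+1 b.+1 / H a.+1 b.+1 = E a b / H a b.+1) /\
    ((0 < b)%N -> forall a, (a < m + b)%N ->
       D a.+1 b.+1 / H a.+1 b.+1 - D a.+1 b / H a.+1 b = E a b / H a.+1 b).
Proof.
move=> sH [hD [hD0 [hD1 hDw]]] [hE [hE0 hEw]] hED.
have hEout b : (b <= n)%N -> E (m + b).+1 b = 0.
  by case: b => [|b] bn; [exact: hE0 | exact: (hEw b.+1 isT bn).1].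
elim=> [|b IH] bn.
  split=> [a a0 ab|//]; rewrite hE0 mul0r; rewrite addn0 in ab.
  have Sp : stair a 1 by rewrite /stair; lia.
  have Sa : stair a.+1 1 by rewrite /stair; lia.
  have gp := stair_weight_gt0 sH Sp; have ga := stair_weight_gt0 sH Sa.
  have gz : H a.+1 0%N = 0 by apply: stair_weight_eq0; rewrite // /stair; lia.
  have eq1 c : (0 < c)%N -> (c <= m)%N -> free || (c < m)%N ->
      D c.+1 1%N * H c 1%N = H c.+1 1%N * D c 1%N.
    move=> c0 cm fc; have := hD c 0%N; rewrite addn0 c0 addn0 hD0 addr0.
    rewrite (stair_weight_eq0 (a := c.+1) (b := 0) sH) ?addr0; last first.
      by rewrite /stair; lia.
    by apply; rewrite // /stair; lia.
  have [fm|] := boolP (free || (a < m)%N).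
    apply/eqP; rewrite subr_eq0 eqr_div ?lt0r_neq0 //; apply/eqP.
    by rewrite [LHS]mulrC -eq1.
  rewrite negb_or -leqNgt => /andP[fr am].
  (* The recursion does not cover the wall here. D is 0 on it by assumption, and 0 along the whole
     bottom row because it starts from [D 1 1 = 0]. *)
  have z c : (0 < c)%N -> (c <= m)%N -> D c 1%N = 0.
    elim: c => // -[_ _ _|c IHc _ cm]; first exact: hD1.
    have := eq1 c.+1 isT ltac:(lia); rewrite cm orbT IHc ?mulr0 //; last lia.
    move=> /(_ isT)/eqP; rewrite mulf_eq0 => /orP[/eqP//|].
    by rewrite gt_eqF // stair_weight_gt0 // /stair; lia.
  rewrite z // mul0r sub0r.
  have -> : a.+1 = (m + 1)%N by lia.
  by rewrite (hDw 1%N isT n_gt0).2 // mul0r oppr0.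
have [IH1 _] := IH (ltnW bn).
(* In the first column the boundary values [E 0 b = D 0 b.+1] take the place of a square. *)
have r0 : D 1%N b.+2 / H 1%N b.+2 - D 1%N b.+1 / H 1%N b.+1 =
    E 0%N b.+1 / H 1%N b.+1.
  have Sp : stair 1 b.+1 by rewrite /stair; lia.
  have Sb : stair 1 b.+2 by rewrite /stair; lia.
  have gp := stair_weight_gt0 sH Sp; have gb := stair_weight_gt0 sH Sb.
  have := hD 0%N b.+1 Sb isT; rewrite (_ : (0 < _)%N); last by lia.
  rewrite (stair_weight_eq0 (a := 0) sH) // add0r orbT => /(_ isT) h.
  rewrite hED //.
  have -> : D 1%N b.+2 / H 1%N b.+2 =
      D 1%N b.+2 * H 1%N b.+1 / H 1%N b.+2 / H 1%N b.+1.
    by field; rewrite !gt_eqF.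
  by rewrite h; field; rewrite !gt_eqF.
have main a : (a.+1 < m + b.+1)%N ->
    D a.+1 b.+2 / H a.+1 b.+2 - D a.+1 b.+1 / H a.+1 b.+1 =
      E a b.+1 / H a.+1 b.+1 ->
    D a.+1 b.+2 / H a.+1 b.+2 - D a.+2 b.+2 / H a.+2 b.+2 =
      E a.+1 b.+1 / H a.+1 b.+2 /\
    D a.+2 b.+2 / H a.+2 b.+2 - D a.+2 b.+1 / H a.+2 b.+1 =
      E a.+1 b.+1 / H a.+2 b.+1.
  move=> am r2.
  have Sp : stair a.+1 b.+1 by rewrite /stair; lia.
  have Sa : stair a.+2 b.+1 by rewrite /stair; lia.
  have Sb : stair a.+1 b.+2 by rewrite /stair; lia.
  have St : stair a.+2 b.+2 by rewrite /stair; lia.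
  apply: square_down (stair_weight_gt0 sH Sa) (stair_weight_gt0 sH Sb)
    (stair_weight_gt0 sH Sp) (stair_weight_gt0 sH St) _ _ r2 (IH1 a.+1 isT _).
  - by apply: hE => //; lia.
  - by apply: hD => //; lia.
  - by lia.
have r2 a : (a < m + b.+1)%N ->
    D a.+1 b.+2 / H a.+1 b.+2 - D a.+1 b.+1 / H a.+1 b.+1 =
      E a b.+1 / H a.+1 b.+1.
  elim: a => [//|a IHa] am; have [] // := main a am (IHa _); lia.
split=> // a a0 am.
have [am'|ma] := ltnP a (m + b.+1).
  case: a a0 am am' => // a _ _ am; have [] // := main a am (r2 a _); lia.
(* What remains is the edge that ends on the wall, again with one argument per boundary
   condition. *)
have {am ma a0} -> : a = (m + b).+1 by lia.
have := r2 (m + b)%N ltac:(lia).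
have Sp : stair (m + b).+1 b.+1 by rewrite /stair; lia.
have Sb : stair (m + b).+1 b.+2 by rewrite /stair; lia.
have St : stair (m + b).+2 b.+2 by rewrite /stair; lia.
have gp := stair_weight_gt0 sH Sp; have gb := stair_weight_gt0 sH Sb.
have gt := stair_weight_gt0 sH St.
have ga : H (m + b).+2 b.+1 = 0.
  by apply: stair_weight_eq0; rewrite // /stair; lia.
have [] := hDw b.+1 isT (ltnW bn); have [_] := hDw b.+2 isT bn.
have [_] := hEw b.+1 isT (ltnW bn).
rewrite !addnS => ew dw dw1 dw2.
case: (free) ew dw dw1 dw2 hD hE {main r2 IH IH1 hD1} => /=.
  move=> /(_ isT) -> _ d0 _ hD _ _; rewrite mul0r.
  have := hD _ _ St; rewrite ga addr0 d0 addr0 => /(_ _ isT) h.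
  have {}h := h ltac:(lia).
  apply/eqP; rewrite subr_eq0 eqr_div ?lt0r_neq0 //; apply/eqP.
  by rewrite h mulrC.
move=> _ /(_ isT) -> _ /(_ isT) -> _ hE; rewrite !mul0r !subr0 => ->.
have := hE _ _ Sp; rewrite ga invr0 add0r => /(_ _ isT) h.
have {}h := h ltac:(lia); rewrite h mulrC.
suff -> : E (m + b).+1 b = 0 by rewrite addr0 mulrC.
exact/hEout/ltnW/ltnW.
Qed.

(** [down_dualP] does not reach E in the top row. There the equation of E is truncated, as H
    vanishes above, and combined with the increments of D / H it yields a quantity conserved along
    the row. *)
Lemma down_dual_top free H D E : stair_weight H -> down_eq free H D ->
  down_dual_eq (~~ free) H E ->
  (forall b, (0 < b)%N -> (b < n)%N -> E 0%N b = D 0%N b.+1) ->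
  forall a, (a < m + n)%N ->
    (D a.+1 n + E a n) / H a.+1 n = (D 1%N n + E 0%N n) / H 1%N n.
Proof.
move=> sH hD hE hED; elim=> [//|a IH] am; rewrite -{}IH; last by lia.
have [/(_ a.+1 isT)] := down_dualP sH hD hE hED (b := n.-1) ltac:(lia).
rewrite prednK // => /(_ ltac:(lia)) r1 _; move: hE => [hE _].
have Sp : stair a.+1 n by rewrite /stair; lia.
have Sa : stair a.+2 n by rewrite /stair; lia.
have gp := stair_weight_gt0 sH Sp; have ga := stair_weight_gt0 sH Sa.
have gb : H a.+1 n.+1 = 0 by apply: stair_weight_eq0; rewrite // /stair; lia.
have := hE a n.-1; rewrite prednK // gb invr0 addr0.
move=> /(_ Sp ltac:(lia)) h; have {}h := h ltac:(lia).
by rewrite !mulrDl h; lra.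
Qed.

(* U, D are sums over all chains and U0, D0 over chains avoiding the wall, on
   I_(k+1); V, E and V0, E0 are the corresponding sums on I_k. *)
Section Pairing.
Variables G H U U0 V V0 D D0 E E0 : nat -> nat -> F.
Hypotheses (sG : stair_weight G) (sH : stair_weight H) (H11 : H 1%N 1%N = 1).
Hypotheses (hU : up_eq true G U) (hU0 : up_eq false G U0).
Hypotheses (hV : up_dual_eq true G V) (hV0 : up_dual_eq false G V0).
Hypotheses (hD : down_eq true H D) (hD0 : down_eq false H D0).
Hypotheses (hE : down_dual_eq true H E) (hE0 : down_dual_eq false H E0).
Hypothesis Utop : forall a, (0 < a)%N -> U a n.+1 = U0 a n.+1.
Hypothesis Vtop : forall a, (0 < a)%N -> (a < m + n)%N ->
  V a n.+1 = U a.+1 n.+1 /\ V0 a n.+1 = U a.+1 n.+1.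
Hypothesis D11 : D 1%N 1%N = 1.
Hypotheses (D02 : D 0%N 2 = 0) (D002 : D0 0%N 2 = 1).
Hypothesis D0b : forall b, (2 < b)%N -> D 0%N b = D0 0%N b.
Hypothesis E0b : forall b, (0 < b)%N -> (b < n)%N ->
  E 0%N b = D0 0%N b.+1 /\ E0 0%N b = D 0%N b.+1.
Hypothesis E0n : E 0%N n = E0 0%N n.
Hypothesis DU : forall a b, stair a b -> (2 < a + b)%N ->
  D a b * U a b - D0 a b * U0 a b = 1.

Let upV := up_dualP sG hU0 hV
  (fun a pa am => etrans (Vtop pa am).1 (Utop (ltn0Sn a))).
Let upV0 := up_dualP sG hU hV0 (fun a pa am => (Vtop pa am).2).
Let downE := down_dualP sH hD0 hE (fun b pb bn => (E0b pb bn).1).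
Let downE0 := down_dualP sH hD hE0 (fun b pb bn => (E0b pb bn).2).

(** Both products vanish at the maximum of M_k, which is not in I_k, and their increments agree
    because U and U0 do in the next row. *)
Lemma top_row_V a : (0 < a)%N -> (a <= m + n)%N ->
  V a n * G a n = V0 a n * G a n.
Proof.
move=> a0 am; move: {2}(m + n - a)%N (erefl (m + n - a)%N) => c.
elim: c a a0 am => [|c IH] a a0 am ac.
  have -> : a = (m + n)%N by lia.
  by rewrite (proj1 (proj2 hV)) (proj1 (proj2 hV0)).
have h1 := (upV n_gt0 (leqnn n)).1 a a0 ltac:(lia).
have h2 := (upV0 n_gt0 (leqnn n)).1 a a0 ltac:(lia).
have := IH a.+1 isT ltac:(lia) ltac:(lia).
by rewrite Utop // in h2; lra.
Qed.

(** The increments of V G and V0 G come from U0 and U in the second column; the equations of U and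
    U0 in the first column, where G has a single lower neighbour, compensate for the exchange. *)
Lemma left_column_V b : (0 < b)%N -> (b <= n)%N ->
  V 1%N b - V0 1%N b = U 1%N b.+1 - U0 1%N b.+1.
Proof.
move=> b0 bn.
have S b' : (0 < b')%N -> (b' <= n)%N -> stair 1 b' by rewrite /stair; lia.
suff: V 1%N b * G 1%N b - V0 1%N b * G 1%N b =
    (U 1%N b.+1 - U0 1%N b.+1) * G 1%N b.
  rewrite -mulrBl => /mulIf; apply; rewrite gt_eqF //.
  by apply: stair_weight_gt0 => //; apply: S.
move: {2}(n - b)%N (erefl (n - b)%N) => c.
elim: c b b0 bn => [|c IH] b b0 bn nb.
  have -> : b = n by lia.
  by rewrite top_row_V // ?Utop // ?subrr ?mul0r //; lia.
have bn' : (b < n)%N by lia.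
have h1 := (upV b0 bn).2 bn' 1%N isT ltac:(lia).
have h2 := (upV0 b0 bn).2 bn' 1%N isT ltac:(lia).
have h3 := IH b.+1 isT bn' ltac:(lia).
have h4 := hU.1 0%N b (S b.+1 isT bn') b0 isT.
have h5 := hU0.1 0%N b (S b.+1 isT bn') b0 ltac:(lia).
rewrite (stair_weight_eq0 (a := 0) sG) // add0r in h4 h5.
lra.
Qed.

Lemma bottom_row_D a : (0 < a)%N -> (a <= m.+1)%N ->
  D a 1%N = H a 1%N /\ D0 a 1%N = 0.
Proof.
elim: a => // -[_ _ _|a IH _ am].
  by rewrite D11 H11; split=> //; apply: (hD0.2.2.1 isT).
have [IHD IHD0] := IH isT (ltnW am).
have S : stair a.+2 1 by rewrite /stair; lia.
have S' : stair a.+1 1 by rewrite /stair; lia.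
have z : H a.+2 0%N = 0 by apply: stair_weight_eq0; rewrite // /stair; lia.
have H0 : H a.+1 1%N != 0 by rewrite gt_eqF // stair_weight_gt0.
split.
  have := hD.1 a.+1 0%N S isT isT.
  by rewrite z hD.2.1 !addr0 IHD => /(mulIf H0).
have [am'|am'] := ltnP a.+1 m.
  have := hD0.1 a.+1 0%N S isT ltac:(lia).
  rewrite z hD0.2.1 !addr0 IHD0 mulr0 => /eqP.
  by rewrite mulf_eq0 (negPf H0) orbF => /eqP.
have -> : a.+2 = (m + 1)%N by lia.
exact: (hD0.2.2.2 1%N isT n_gt0).2.
Qed.

Lemma left_column_D b : (1 < b)%N -> (b <= n)%N -> D 1%N b = D0 1%N b.
Proof.
have S b' : (0 < b')%N -> (b' <= n)%N -> stair 1 b' by rewrite /stair; lia.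
elim: b => // -[|b] // IH _ bn.
have H0 : H 1%N b.+1 != 0 by rewrite gt_eqF // stair_weight_gt0 // S // ltnW.
apply: (mulIf H0).
have h4 := hD.1 0%N b.+1 (S b.+2 isT bn) isT isT.
have h5 := hD0.1 0%N b.+1 (S b.+2 isT bn) isT ltac:(lia).
rewrite (stair_weight_eq0 (a := 0) sH) // add0r in h4 h5; rewrite h4 h5.
congr (_ * _); case: b {h4 h5} IH bn H0 => [|b] IH bn _.
  (* The unit that enters (1, 2) comes from (1, 1) for D and from (0, 2) for D0. *)
  by rewrite D02 D002 D11 (hD0.2.2.1 isT) add0r addr0.
by rewrite IH // ?D0b // ltnW.
Qed.

(** The pairs (D0, E) and (D, E0) have the same conserved quantity along the top row, since they
    agree at its left end. *)
Lemma difference_top a : (0 < a)%N -> (a < m + n)%N -> (1 < n)%N ->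
  E a n - E0 a n = D a.+1 n - D0 a.+1 n.
Proof.
move=> a0 am n1; have Sa : stair a.+1 n by rewrite /stair; lia.
apply: (mulIf (invr_neq0 (lt0r_neq0 (stair_weight_gt0 sH Sa)))).
have h1 := down_dual_top sH hD0 hE (fun b pb bn => (E0b pb bn).1) am.
have h2 := down_dual_top sH hD hE0 (fun b pb bn => (E0b pb bn).2) am.
rewrite left_column_D // -E0n -h1 in h2; lra.
Qed.

Lemma bottom_row_V a : (0 < a)%N -> (a <= m.+1)%N -> V0 a 1%N = U a.+1 1%N.
Proof.
move=> a0 am; move: {2}(m.+1 - a)%N (erefl (m.+1 - a)%N) => c.
elim: c a a0 am => [|c IH] a a0 am ac.
  have -> : a = (m + 1)%N by lia.
  by rewrite (hV0.2.2 1%N isT n_gt0).2 // (hU.2 1%N isT n_gt0).1.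
have S : stair a.+1 1 by rewrite /stair; lia.
have S' : stair a 1 by rewrite /stair; lia.
have z : G a.+1 0%N = 0 by apply: stair_weight_eq0; rewrite // /stair; lia.
have Gp := stair_weight_gt0 sG S'.
have h1 := (upV0 (ltn0Sn 0) n_gt0).1 a a0 ltac:(lia).
have := hU.1 a 0%N S ltac:(lia) isT; rewrite z addr0 -(IH a.+1) //; [|lia..].
move=> h2; apply: (mulIf (lt0r_neq0 Gp)); lra.
Qed.

(** Expressing V and V0 by their values in row b - 1 yields D U - D0 U0 = 1 at (a + 1, b) and a
    mixed term that the last hypothesis cancels. *)
Lemma pair_right a b : (0 < a)%N -> (a < m + b)%N -> (0 < b)%N -> (b <= n)%N ->
  ((1 < b)%N -> D0 a.+1 b * V a b.-1 = D a.+1 b * V0 a b.-1) ->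
  D a.+1 b * V0 a b - D0 a.+1 b * V a b = 1.
Proof.
move=> a0 am b0 bn T.
have S : stair a.+1 b by rewrite /stair; lia.
have L := DU S ltac:(lia).
case: b b0 am bn T S L => // -[_ am bn _ S L|b _ am bn /(_ isT) /= T S L].
  have [DH D0z] := bottom_row_D (ltn0Sn a) ltac:(lia).
  rewrite D0z !mul0r !subr0 in L *.
  by rewrite bottom_row_V //; lia.
have S' : stair a b.+2 by rewrite /stair; lia.
have Gp := stair_weight_gt0 sG S'.
have h1 := (upV (ltn0Sn b) (ltnW bn)).2 bn a a0 ltac:(lia).
have h2 := (upV0 (ltn0Sn b) (ltnW bn)).2 bn a a0 ltac:(lia).
apply: (mulIf (lt0r_neq0 Gp)); rewrite mul1r.
transitivity
  (G a b.+2 * (D a.+1 b.+2 * U a.+1 b.+2 - D0 a.+1 b.+2 * U0 a.+1 b.+2) +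
   (D a.+1 b.+2 * V0 a b.+1 - D0 a.+1 b.+2 * V a b.+1) * G a b.+1).
  have e1 : V a b.+2 * G a b.+2 =
      V a b.+1 * G a b.+1 + G a b.+2 * U0 a.+1 b.+2.
    by rewrite -h1; ring.
  have e2 : V0 a b.+2 * G a b.+2 =
      V0 a b.+1 * G a b.+1 + G a b.+2 * U a.+1 b.+2.
    by rewrite -h2; ring.
  by rewrite mulrBl -2!mulrA e1 e2; ring.
by rewrite L T; ring.
Qed.

(** As for [pair_right], with the values in column a - 1. In the first column D and D0 agree, so
    only V - V0 enters. *)
Lemma pair_up a b : (0 < a)%N -> (a <= m + b)%N -> (0 < b)%N -> (b < n)%N ->
  ((1 < a)%N -> D0 a b.+1 * V a.-1 b = D a b.+1 * V0 a.-1 b) ->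
  D0 a b.+1 * V a b - D a b.+1 * V0 a b = 1.
Proof.
move=> a0 am b0 bn T.
have S : stair a b.+1 by rewrite /stair; lia.
have L := DU S ltac:(lia).
case: a a0 am T S L => // -[_ am _ S L|a _ am /(_ isT) /= T S L].
  have h := left_column_V b0 (ltnW bn).
  have E1 := left_column_D (b := b.+1) b0 bn.
  rewrite -E1 in L *; rewrite -mulrBr h -L; ring.
have S' : stair a.+2 b by rewrite /stair; lia.
have Gp := stair_weight_gt0 sG S'.
have h1 := (upV b0 (ltnW bn)).1 a.+1 isT ltac:(lia).
have h2 := (upV0 b0 (ltnW bn)).1 a.+1 isT ltac:(lia).
apply: (mulIf (lt0r_neq0 Gp)); rewrite mul1r.
transitivity
  (G a.+2 b * (D a.+2 b.+1 * U a.+2 b.+1 - D0 a.+2 b.+1 * U0 a.+2 b.+1) +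
   (D0 a.+2 b.+1 * V a.+1 b - D a.+2 b.+1 * V0 a.+1 b) * G a.+1 b).
  have e1 : V a.+2 b * G a.+2 b =
      V a.+1 b * G a.+1 b - G a.+2 b * U0 a.+2 b.+1.
    by rewrite -h1; ring.
  have e2 : V0 a.+2 b * G a.+2 b =
      V0 a.+1 b * G a.+1 b - G a.+2 b * U a.+2 b.+1.
    by rewrite -h2; ring.
  by rewrite mulrBl -2!mulrA e1 e2; ring.
by rewrite L T; ring.
Qed.

(* The defect c at the top of the square is a weighted mean of the defects at
   its two neighbours, which q1 and q2 state to be 0, and it is proportional
   to the difference of the pairing from 1. *)
Lemma pairing_square (A B t da db dt da' db' dt' e e' v v' : F) :
  0 < A -> 0 < B -> 0 < t ->
  db / B - dt / t = e' / B -> dt / t - da / A = e' / A ->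
  db' / B - dt' / t = e / B -> dt' / t - da' / A = e / A ->
  da * v' - da' * v = 1 -> db' * v - db * v' = 1 ->
  dt' * v = dt * v' /\ e * v - e' * v' = 1.
Proof.
move=> A0 B0 t0 h1 h2 h3 h4 q1 q2.
pose c := (dt' * v - dt * v') / t.
have AB : A + B != 0 by rewrite gt_eqF // addr_gt0.
have cB : c * B = 1 - (e * v - e' * v').
  have -> : e = (db' / B - dt' / t) * B by rewrite h3 divfK ?lt0r_neq0.
  have -> : e' = (db / B - dt / t) * B by rewrite h1 divfK ?lt0r_neq0.
  by rewrite /c -q2; field; rewrite !lt0r_neq0.
have cA : c * A = (e * v - e' * v') - 1.
  have -> : e = (dt' / t - da' / A) * A by rewrite h4 divfK ?lt0r_neq0.
  have -> : e' = (dt / t - da / A) * A by rewrite h2 divfK ?lt0r_neq0.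
  by rewrite /c -q1; field; rewrite !lt0r_neq0.
have c0 : c = 0.
  have /eqP : c * (A + B) = 0 by lra.
  by rewrite mulf_eq0 (negPf AB) orbF => /eqP.
split; last by rewrite c0 in cB; lra.
move/eqP: c0; rewrite mulf_eq0 invr_eq0 (gt_eqF t0) orbF subr_eq0.
by move/eqP.
Qed.

(** The first identity at the left and lower neighbours is what [pair_up] and [pair_right] require
    at the current square, so both identities run in one double induction. *)
Lemma pairing_inner b : (0 < b)%N -> (b < n)%N -> forall a, (0 < a)%N ->
  (a <= m + b)%N ->
  D0 a.+1 b.+1 * V a b = D a.+1 b.+1 * V0 a b /\
  E a b * V a b - E0 a b * V0 a b = 1.
Proof.
elim: b => // b IHb _ bn; elim=> // a IHa _ am.
have S : stair a.+1 b.+1 by rewrite /stair; lia.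
have Sb : stair a.+1 b.+2 by rewrite /stair; lia.
have St : stair a.+2 b.+2 by rewrite /stair; lia.
have qB : D0 a.+1 b.+2 * V a.+1 b.+1 - D a.+1 b.+2 * V0 a.+1 b.+1 = 1.
  apply: pair_up => // a1 /=; apply: (IHa _ _).1; lia.
have d1 := (downE0 bn).1 a.+1 isT am; have d2 := (downE bn).1 a.+1 isT am.
have [am'|ma] := ltnP a.+1 (m + b.+1).
  have Sa : stair a.+2 b.+1 by rewrite /stair; lia.
  have qA : D a.+2 b.+1 * V0 a.+1 b.+1 - D0 a.+2 b.+1 * V a.+1 b.+1 = 1.
    apply: pair_right; rewrite // ?(ltnW bn) //.
    case: b IHb bn am am' {S Sb St Sa qB d1 d2 IHa} => // b IHb bn am am' _ /=.
    by apply: (IHb _ _ _ _ _).1; lia.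
  apply: pairing_square (stair_weight_gt0 sH Sa) (stair_weight_gt0 sH Sb)
    (stair_weight_gt0 sH St) d1 _ d2 _ qA qB.
    by apply: (downE0 bn).2.
  by apply: (downE bn).2.
(* There is no square at the wall, but D0 and V0 vanish: the first identity reads 0 = 0, the second
   reduces to [qB]. *)
have {ma} aE : a.+1 = (m + b.+1)%N by lia.
have D0t : D0 a.+2 b.+2 = 0.
  have -> : a.+2 = (m + b.+2)%N by lia.
  by apply: (hD0.2.2.2 b.+2 isT bn).2.
have V0p : V0 a.+1 b.+1 = 0.
  by rewrite aE; apply: (hV0.2.2 b.+1 isT (ltnW bn)).2.
rewrite D0t V0p !mul0r !mulr0 !subr0; rewrite V0p mulr0 subr0 in qB; split=> //.
have Bn := lt0r_neq0 (stair_weight_gt0 sH Sb).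
by move: d2; rewrite D0t mul0r subr0 => /(mulIf (invr_neq0 Bn)) <-.
Qed.

(** In this row V = V0, so only E - E0 matters, and it equals the difference D - D0 that occurs in
    [pair_right]. *)
Lemma pairing_top a : (0 < a)%N -> (a < m + n)%N -> (1 < n)%N ->
  E a n * V a n - E0 a n * V0 a n = 1.
Proof.
move=> a0 am n1.
have S : stair a n by rewrite /stair; lia.
have Sa : stair a.+1 n by rewrite /stair; lia.
have Vn : V a n = V0 a n.
  apply: (mulIf (lt0r_neq0 (stair_weight_gt0 sG S))).
  by apply: top_row_V => //; lia.
have Hn := invr_neq0 (lt0r_neq0 (stair_weight_gt0 sH Sa)).
have : D a.+1 n * V0 a n - D0 a.+1 n * V a n = 1.
  apply: pair_right => // _.
  have [] := @pairing_inner n.-1 ltac:(lia) ltac:(lia) a a0 ltac:(lia).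
  by rewrite prednK.
have := difference_top a0 am n1; rewrite Vn -!mulrBl => -> //.
Qed.

(** The last two parts hand the differences over to the regions left of and above M_k. *)
Lemma pairing : (1 < n)%N ->
  [/\ forall a b, stair a b -> (a + b < m + n + n)%N ->
        E a b * V a b - E0 a b * V0 a b = 1,
      forall b, (0 < b)%N -> (b <= n)%N ->
        V 1%N b - V0 1%N b = U 1%N b.+1 - U0 1%N b.+1 &
      forall a, (0 < a)%N -> (a < m + n)%N ->
        E a n - E0 a n = D a.+1 n - D0 a.+1 n].
Proof.
move=> n1; split=> [a b|b b0 bn|a a0 am].
- move=> /and4P[a0 am b0 bn] abm; have [bn'|nb] := ltnP b n.
    by have [] := pairing_inner b0 bn' a0 am.
  have bE : b = n by lia.
  by rewrite bE in abm *; apply: pairing_top => //; lia.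
- exact: left_column_V.
- exact: difference_top.
Qed.

End Pairing.
End Staircase.
(** * Chain sums on subsets of the grid *)

(* [ext] is sealed with this key: otherwise comparing [ext f i j] with [ext f
   i.+1 j] by conversion unfolds [inord], which takes minutes. *)
Fact ext_key : unit. Proof. by []. Qed.

Section GridSums.
Variables r s : nat.
Local Notation T := (grid r s).
Implicit Types (p q : T) (i j : nat).

Lemma le_grid p q : (p <= q)%O = (p.1 <= q.1)%N && (p.2 <= q.2)%N.
Proof. by []. Qed.

Lemma lt_grid p q : (p < q)%O =
  [&& (p.1 <= q.1)%N, (p.2 <= q.2)%N & (p.1 + p.2 < q.1 + q.2)%N].
Proof.
rewrite lt_neqAle le_grid.
case: p q => [[a ha] [b hb]] [[a' ha'] [b' hb']] /=.
rewrite xpair_eqE -!val_eqE /=; lia.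
Qed.

Lemma ptE i j : (i <= r + s)%N -> (j <= s)%N ->
  ((pt r s i j).1 = i :> nat) * ((pt r s i j).2 = j :> nat).
Proof. by move=> ir js; rewrite /= !inordK. Qed.

Lemma pt_val p : pt r s p.1 p.2 = p.
Proof. by case: p => a b; rewrite /pt /= !inord_val. Qed.

Lemma eq_pt p i j : (i <= r + s)%N -> (j <= s)%N ->
  (p == pt r s i j) = (p.1 == i :> nat) && (p.2 == j :> nat).
Proof.
move=> ir js; apply/eqP/andP => [->|[/eqP <- /eqP <-]].
  by rewrite !ptE ?eqxx.
by rewrite pt_val.
Qed.

Variables (A : nat -> nat -> bool) (P : {set T}).
Hypothesis A_bound : forall i j, A i j ->
  [&& 0 < i, i <= r + s, 0 < j & j <= s]%N.
Hypothesis PA : forall p, (p \in P) = A p.1 p.2.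

Variable F : comNzRingType.
Implicit Types f : T -> F.

Definition ext f : nat -> nat -> F :=
  locked_with ext_key (fun i j => if A i j then f (pt r s i j) else 0).

Lemma extE f i j : ext f i j = if A i j then f (pt r s i j) else 0.
Proof. by rewrite /ext unlock. Qed.

Lemma mem_pt i j : A i j -> pt r s i j \in P.
Proof. by move=> a; have b := A_bound a; rewrite PA !ptE //; lia. Qed.

Lemma sum_ext f i j :
  \sum_(q in P | (q.1 == i :> nat) && (q.2 == j :> nat)) f q = ext f i j.
Proof.
rewrite extE; case: ifP => [a|a].
  have b := A_bound a.
  rewrite (big_pred1 (pt r s i j)) // => q /=; rewrite PA.
  apply/and3P/eqP => [[_ /eqP <- /eqP <-]|->]; first by rewrite pt_val.
  by rewrite !ptE ?eqxx //; lia.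
rewrite big_pred0 // => q; rewrite PA.
by apply/and3P => -[+ /eqP E1 /eqP E2]; rewrite E1 E2 a.
Qed.

Lemma sum_ext2 f i j i' j' : (i, j) != (i', j') ->
  \sum_(q in P | (q.1 == i :> nat) && (q.2 == j :> nat) ||
                 (q.1 == i' :> nat) && (q.2 == j' :> nat)) f q =
  ext f i j + ext f i' j'.
Proof.
move=> ne; rewrite -2!sum_ext.
rewrite (bigID (fun q : T => (q.1 == i :> nat) && (q.2 == j :> nat))) /=.
congr (_ + _); apply: eq_bigl => q; case: (q \in P) => //=.
  by lia.
by move: ne; rewrite xpair_eqE; lia.
Qed.

(** The first hypothesis makes unit steps the only covers; the last summand is the empty chain
    beyond a maximal point. *)
Lemma up_sum_ext f i j :
  (forall i' j', A i' j' -> (i <= i')%N -> (j <= j')%N -> (i + j < i' + j')%N ->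
     (i < i')%N && A i.+1 j || (j < j')%N && A i j.+1) -> A i j ->
  ext (up_sum P f) i j = ext f i j *
    (ext (up_sum P f) i.+1 j + ext (up_sum P f) i j.+1 +
     (~~ (A i.+1 j || A i j.+1))%:R).
Proof.
move=> step a; have b := A_bound a.
rewrite [LHS]extE [ext f _ _]extE a.
have [bi bj] : (i <= r + s)%N /\ (j <= s)%N by lia.
have [ab|] := boolP (_ || _); last first.
  rewrite negb_or => /andP[/negPf a1 /negPf a2].
  rewrite !extE a1 a2 !add0r mulr1; apply: up_sum_maximal.
  apply/setP => q; rewrite !inE PA lt_grid !ptE //; apply/negP.
  move=> /and4P[aq h1 h2 h3]; have := step _ _ aq h1 h2 h3.
  by rewrite a1 a2 !andbF.
rewrite addr0 up_sum_rec; last first.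
  case/orP: ab => ab; apply/set0Pn;
    [exists (pt r s i.+1 j)|exists (pt r s i j.+1)];
    have b' := A_bound ab; rewrite inE mem_pt // lt_grid !ptE //; lia.
congr (_ * _); rewrite -sum_ext2; last by rewrite xpair_eqE; lia.
apply: eq_bigl => -[[x hx] [y hy]].
pose q : T := (Ordinal hx, Ordinal hy); rewrite -/q.
rewrite inE lt_grid !ptE //=.
apply/andP/andP => [[/andP[qP lq] /eqP q0]|[qP qE]].
  split=> //; move: (qP); rewrite PA /= => aq.
  have [h1 h2 h3] := and3P lq.
  have noq p : p \in P -> (pt r s i j < p)%O -> ~~ (p < q)%O.
    move=> pP l1; apply/negP => l2; have: p \in below (above P (pt r s i j)) q.
      by rewrite !inE pP l1.
    by rewrite q0 inE.
  case/orP: (step _ _ aq h1 h2 h3) => /andP[lt1 a'].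
    have b' := A_bound a'; have := noq _ (mem_pt a').
    rewrite !lt_grid !ptE //=; lia.
  have b' := A_bound a'; have := noq _ (mem_pt a').
  rewrite !lt_grid !ptE //=; lia.
rewrite qP; split; first by lia.
apply/eqP/setP => p; rewrite !inE !lt_grid !ptE //=; lia.
Qed.

Lemma down_sum_ext f i j :
  (forall i' j', A i' j' -> (i' <= i.+1)%N -> (j' <= j.+1)%N ->
     (i' + j' < i.+1 + j.+1)%N ->
     (i' < i.+1)%N && A i j.+1 || (j' < j.+1)%N && A i.+1 j) -> A i.+1 j.+1 ->
  ext (down_sum P f) i.+1 j.+1 = ext f i.+1 j.+1 *
    (ext (down_sum P f) i j.+1 + ext (down_sum P f) i.+1 j +
     (~~ (A i j.+1 || A i.+1 j))%:R).
Proof.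
move=> step a; have b := A_bound a.
rewrite [LHS]extE [ext f _ _]extE a.
have [bi bj] : (i.+1 <= r + s)%N /\ (j.+1 <= s)%N by lia.
have [ab|] := boolP (_ || _); last first.
  rewrite negb_or => /andP[/negPf a1 /negPf a2].
  rewrite !extE a1 a2 !add0r mulr1; apply: down_sum_minimal.
  apply/setP => q; rewrite !inE PA lt_grid !ptE //; apply/negP.
  move=> /and4P[aq h1 h2 h3]; have := step _ _ aq h1 h2 h3.
  by rewrite a1 a2 !andbF.
rewrite addr0 down_sum_rec; last first.
  case/orP: ab => ab; apply/set0Pn;
    [exists (pt r s i j.+1)|exists (pt r s i.+1 j)];
    have b' := A_bound ab; rewrite inE mem_pt // lt_grid !ptE //; lia.
congr (_ * _); rewrite -sum_ext2; last by rewrite xpair_eqE; lia.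
apply: eq_bigl => -[[x hx] [y hy]].
pose q : T := (Ordinal hx, Ordinal hy); rewrite -/q.
rewrite inE lt_grid !ptE //=.
apply/andP/andP => [[/andP[qP lq] /eqP q0]|[qP qE]].
  split=> //; move: (qP); rewrite PA /= => aq.
  have [h1 h2 h3] := and3P lq.
  have noq p : p \in P -> (p < pt r s i.+1 j.+1)%O -> ~~ (q < p)%O.
    move=> pP l1; apply/negP => l2.
    have: p \in above (below P (pt r s i.+1 j.+1)) q.
      by rewrite !inE pP l1.
    by rewrite q0 inE.
  case/orP: (step _ _ aq h1 h2 h3) => /andP[lt1 a'].
    have b' := A_bound a'; have := noq _ (mem_pt a').
    rewrite !lt_grid !ptE //=; lia.
  have b' := A_bound a'; have := noq _ (mem_pt a').
  rewrite !lt_grid !ptE //=; lia.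
rewrite qP; split; first by lia.
apply/eqP/setP => p; rewrite !inE !lt_grid !ptE //=; lia.
Qed.

End GridSums.

(** * The posets I_k and M_k *)

Section Borders.
Variables r s : nat.
Implicit Types (i j t : nat).

Definition origin_border t : {set grid r s} := pt r s t 1 |: left_border r s.

Lemma polygonal_chainsE t :
  polygonal_chains r s t = meeting (Iposet r s t) (origin_border t).
Proof.
apply/setP => C; rewrite !inE; congr (_ && _).
apply/orP/set0Pn => [[/set0Pn[p]|pC]|[p]].
- rewrite inE => /andP[pC pL]; exists p.
  by rewrite !inE in pL *; rewrite pC pL orbT.
- by exists (pt r s t 1); rewrite !inE pC eqxx.
- rewrite inE => /andP[pC]; rewrite in_setU1 => /predU1P[<-|pL]; first by right.
  by left; apply/set0Pn; exists p; rewrite inE pC.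
Qed.

Lemma mem_left_border i j : (i <= r + s)%N -> (0 < j)%N -> (j <= s)%N ->
  (pt r s i j \in left_border r s) = (i.+1 == r + j)%N.
Proof. by move=> ir j0 js; rewrite inE !ptE //; lia. Qed.

Lemma mem_origin_border t i j : (i <= r + s)%N -> (0 < j)%N -> (j <= s)%N ->
  (t <= r + s)%N ->
  (pt r s i j \in origin_border t) =
    ((i == t) && (j == 1) || (i.+1 == r + j))%N.
Proof.
move=> ir j0 js ts; rewrite in_setU1 mem_left_border //; congr (_ || _).
by rewrite eq_pt ?ptE //; lia.
Qed.

End Borders.

Section Regions.
Variables r s : nat.
Hypothesis s_le_r : (s <= r)%N.
Implicit Types (i j k : nat) (p : grid r s).

Definition inI k i j : bool :=
  [&& 0 < i, 0 < j, j <= s, i < r + j &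
      (j <= k) && (k < i + j) || [&& k < j, k <= i & i < r + k]]%N.

Definition inM k i j : bool := [&& k <= i, 0 < j, j <= k.+1 & i < r + j]%N.

Lemma in_Iposet k p : (0 < k)%N -> (k <= s)%N ->
  (p \in Iposet r s k) = inI k p.1 p.2.
Proof.
move=> k0 ks; case: p => [[i hi] [j hj]]; rewrite !inE /inI /=; lia.
Qed.

Lemma in_Mposet k p : (0 < k)%N -> (k < s)%N ->
  (p \in Mposet r s k) = inM k p.1 p.2.
Proof.
move=> k0 ks; case: p => [[i hi] [j hj]]; rewrite !inE /inM /=; lia.
Qed.

Lemma inI_bound k i j : (0 < k)%N -> (k <= s)%N -> inI k i j ->
  [&& 0 < i, i <= r + s, 0 < j & j <= s]%N.
Proof. by rewrite /inI; lia. Qed.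

Lemma inM_bound k i j : (0 < k)%N -> (k < s)%N -> inM k i j ->
  [&& 0 < i, i <= r + s, 0 < j & j <= s]%N.
Proof. by rewrite /inM; lia. Qed.

Variable F : comNzRingType.

Lemma I_up_sum k (f : grid r s -> F) i j : (0 < k)%N -> (k <= s)%N ->
  inI k i j ->
  ext (inI k) (up_sum (Iposet r s k) f) i j = ext (inI k) f i j *
    (ext (inI k) (up_sum (Iposet r s k) f) i.+1 j +
     ext (inI k) (up_sum (Iposet r s k) f) i j.+1 +
     ((i.+1 == r + k) && (j == s))%N%:R).
Proof.
move=> k0 ks a; rewrite (up_sum_ext (P := Iposet r s k)) //.
- by congr (_ * (_ + _%:R)); move: a; rewrite /inI; lia.
- by move=> *; apply: (inI_bound k0 ks).
- by move=> p; apply: in_Iposet.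
- by move=> i' j'; move: a; rewrite /inI; lia.
Qed.

Lemma I_down_sum k (f : grid r s -> F) i j : (0 < k)%N -> (k <= s)%N ->
  inI k i.+1 j.+1 ->
  ext (inI k) (down_sum (Iposet r s k) f) i.+1 j.+1 = ext (inI k) f i.+1 j.+1 *
    (ext (inI k) (down_sum (Iposet r s k) f) i j.+1 +
     ext (inI k) (down_sum (Iposet r s k) f) i.+1 j + (i + j.+1 == k)%N%:R).
Proof.
move=> k0 ks a; rewrite (down_sum_ext (P := Iposet r s k)) //.
- by congr (_ * (_ + _%:R)); move: a; rewrite /inI; lia.
- by move=> *; apply: (inI_bound k0 ks).
- by move=> p; apply: in_Iposet.
- by move=> i' j'; move: a; rewrite /inI; lia.
Qed.

Lemma M_up_sum k (f : grid r s -> F) i j : (0 < k)%N -> (k < s)%N ->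
  inM k i j ->
  ext (inM k) (up_sum (Mposet r s k) f) i j = ext (inM k) f i j *
    (ext (inM k) (up_sum (Mposet r s k) f) i.+1 j +
     ext (inM k) (up_sum (Mposet r s k) f) i j.+1 +
     ((i == r + k) && (j == k.+1))%N%:R).
Proof.
move=> k0 ks a; rewrite (up_sum_ext (P := Mposet r s k)) //.
- by congr (_ * (_ + _%:R)); move: a; rewrite /inM; lia.
- by move=> *; apply: (inM_bound k0 ks).
- by move=> p; apply: in_Mposet.
- by move=> i' j'; move: a; rewrite /inM; lia.
Qed.

Lemma M_down_sum k (f : grid r s -> F) i j : (0 < k)%N -> (k < s)%N ->
  inM k i.+1 j.+1 ->
  ext (inM k) (down_sum (Mposet r s k) f) i.+1 j.+1 = ext (inM k) f i.+1 j.+1 *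
    (ext (inM k) (down_sum (Mposet r s k) f) i j.+1 +
     ext (inM k) (down_sum (Mposet r s k) f) i.+1 j +
     ((i.+1 == k) && (j == 0))%N%:R).
Proof.
move=> k0 ks a; rewrite (down_sum_ext (P := Mposet r s k)) //.
- by congr (_ * (_ + _%:R)); move: a; rewrite /inM; lia.
- by move=> *; apply: (inM_bound k0 ks).
- by move=> p; apply: in_Mposet.
- by move=> i' j'; move: a; rewrite /inM; lia.
Qed.
End Regions.

(** * Labels of [zeta] expressed through chain sums on M_k *)

Section ZetaFacts.
Variables (R : realType) (r s k' : nat).
Local Notation k := k'.+1.
Hypotheses (ks : (k < s)%N) (s_le_r : (s <= r)%N).
Local Notation I := (Iposet r s k).
Local Notation I' := (Iposet r s k.+1).
Local Notation M := (Mposet r s k).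
Local Notation inI := (inI r s).
Local Notation inM := (inM r).
Implicit Types (i j : nat) (x y : {ffun grid r s -> R}).

Let k_gt0 : (0 < k)%N. Proof. by []. Qed.
Let ks_le : (k <= s)%N. Proof. exact: ltnW. Qed.

Lemma in_I p : (p \in I) = inI k p.1 p.2.
Proof. exact: in_Iposet. Qed.
Lemma in_I' p : (p \in I') = inI k.+1 p.1 p.2.
Proof. exact: in_Iposet. Qed.
Lemma in_M p : (p \in M) = inM k p.1 p.2.
Proof. exact: in_Mposet. Qed.

Lemma pt_in_M i j : inM k i j -> pt r s i j \in M.
Proof.
move=> a; have b := inM_bound s_le_r k_gt0 ks a.
by rewrite in_M !ptE //; lia.
Qed.

Section Labels.
Variables (w : seq (grid r s)) (x : {ffun grid r s -> R}).
Hypotheses (w_lin : linear_extension M w) (x_gt0 : positive_on I' x).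

Definition old_label := ext (inI k.+1) x.
Definition new_label := ext (inI k) (zeta k w x).
(** The function G behind the labels on M_k both before and after inverse rowmotion. *)
Definition down_weight := ext (inM k) (down_sum M (xbar k x)).

Lemma xbar_gt0 : positive_on M (xbar k x).
Proof.
move=> [[i hi] [j hj]]; rewrite in_M /= => pM.
rewrite ffunE eq_pt /=; try by lia.
case: ifP => // pk; apply: x_gt0; rewrite in_I' /=.
by move: pM pk; rewrite /inM /inI; lia.
Qed.

Lemma down_weight_gt0 i j : inM k i j -> 0 < down_weight i j.
Proof.
move=> a; rewrite /down_weight extE a; apply: down_sum_gt0.
  exact: xbar_gt0.
exact: pt_in_M.
Qed.

Lemma down_weight_rec i j : inM k i.+1 j.+1 -> ~~ ((i.+1 == k) && (j == 0))%N ->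
  down_weight i.+1 j.+1 =
  old_label i.+1 j.+1 * (down_weight i j.+1 + down_weight i.+1 j).
Proof.
move=> a ne; rewrite /down_weight M_down_sum // (negPf ne) addr0.
have b := inM_bound s_le_r k_gt0 ks a.
congr (_ * _); rewrite /old_label !extE a.
have -> : inI k.+1 i.+1 j.+1 by move: a ne; rewrite /inM /inI; lia.
by rewrite ffunE eq_pt ?ptE; [rewrite (negPf ne) | lia..].
Qed.

Lemma down_weight_min : down_weight k 1 = 1.
Proof.
have a : inM k k 1 by rewrite /inM; lia.
rewrite /down_weight M_down_sum // !eqxx /= !extE a.
have -> : inM k k' 1 = false by rewrite /inM; lia.
have -> : inM k k 0 = false by rewrite /inM; lia.
by rewrite !add0r mulr1 ffunE eqxx.
Qed.

Lemma zeta_M p : p \in M ->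
  zeta k w x p = rowmotion_inv M w (xbar k x) p.
Proof. by rewrite ffunE => ->. Qed.

Lemma new_label_left i j : (i < k)%N -> new_label i j = old_label i j.+1.
Proof.
move=> ik; rewrite /new_label /old_label !extE.
have -> : inI k.+1 i j.+1 = inI k i j by rewrite /inI; lia.
case: ifP => // a; have b := inI_bound s_le_r k_gt0 ks_le a.
rewrite ffunE in_M !ptE; try by lia.
have -> : inM k i j = false by rewrite /inM; lia.
by have -> : (k.+1 < j)%N = false by move: a; rewrite /inI; lia.
Qed.

Lemma new_label_up i j : (k.+1 < j)%N -> new_label i j = old_label i.+1 j.
Proof.
move=> jk; rewrite /new_label /old_label !extE.
have -> : inI k.+1 i.+1 j = inI k i j by rewrite /inI; lia.
case: ifP => // a; have b := inI_bound s_le_r k_gt0 ks_le a.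
rewrite ffunE in_M !ptE; try by lia.
have -> : inM k i j = false by rewrite /inM; lia.
by rewrite jk.
Qed.

(** This is D U = 1 for antichain rowmotion on M_k, applied to the preimage of [xbar k x]; outside
    M_k it holds because 0^-1 = 0. *)
Lemma up_weightE i j :
  ext (inM k) (up_sum M (rowmotion_inv M w (xbar k x))) i j =
  (down_weight i j)^-1.
Proof.
rewrite /down_weight !extE; case: ifP => [a|]; last by rewrite invr0.
have [z0 E] := rowmotion_invK w_lin xbar_gt0.
have pM : pt r s i j \in M.
  exact: pt_in_M.
have := toggles_down_up (x := rowmotion_inv M w (xbar k x)) w_lin.
rewrite -/(rowmotion _ _ _) E => /(_ _ _ pM) h.
apply: (mulfI (x := down_sum M (xbar k x) (pt r s i j))).
  by rewrite gt_eqF // down_sum_gt0 //; exact: xbar_gt0.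
rewrite divff ?h //; last by rewrite gt_eqF // down_sum_gt0 //; exact: xbar_gt0.
by move=> p' p'M; rewrite gt_eqF // xbar_gt0.
Qed.

Lemma down_weightV_rec i j : inM k i j -> ~~ ((i == r + k) && (j == k.+1))%N ->
  (down_weight i j)^-1 =
  new_label i j * ((down_weight i.+1 j)^-1 + (down_weight i j.+1)^-1).
Proof.
move=> a ne.
have := M_up_sum s_le_r (rowmotion_inv M w (xbar k x)) k_gt0 ks a.
rewrite (negPf ne) addr0 3!up_weightE.
move=> h; apply: (etrans h); congr (_ * _).
have b := inM_bound s_le_r k_gt0 ks a.
rewrite /new_label !extE a.
have -> : inI k i j by move: a ne; rewrite /inM /inI; lia.
by rewrite zeta_M // in_M !ptE //; lia.
Qed.

End Labels.
End ZetaFacts.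

(** * Equivariance of zeta *)

Section Equivariance.
Variables (R : realType) (r s k' : nat).
Local Notation k := k'.+1.
Hypotheses (ks : (k < s)%N) (s_le_r : (s <= r)%N).
Local Notation I := (Iposet r s k).
Local Notation I' := (Iposet r s k.+1).
Local Notation M := (Mposet r s k).
Local Notation inI := (inI r s).
Local Notation inM := (inM r).
Local Notation L := (left_border r s).
Local Notation S := (origin_border r s).
Local Notation stair_k := (stair (r - k) k.+1).
Implicit Types (i j a b t : nat) (x y : {ffun grid r s -> R}).
Implicit Types f : grid r s -> R.

Let k_gt0 : (0 < k)%N. Proof. by []. Qed.
Let ks_le : (k <= s)%N. Proof. exact: ltnW. Qed.

Definition up_I t f := ext (inI t) (up_sum (Iposet r s t) f).
Definition down_I t f := ext (inI t) (down_sum (Iposet r s t) f).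

Lemma stairE a b : stair_k a b = inM k (a + k') b.
Proof. by rewrite /stair /inM; lia. Qed.

Lemma up_I_out t f i j : inI t i j = false -> up_I t f i j = 0.
Proof. by rewrite /up_I extE => ->. Qed.

Lemma down_I_out t f i j : inI t i j = false -> down_I t f i j = 0.
Proof. by rewrite /down_I extE => ->. Qed.

Lemma up_I_rec t f i j : (0 < t)%N -> (t <= s)%N -> inI t i j ->
  up_I t f i j = ext (inI t) f i j *
    (up_I t f i.+1 j + up_I t f i j.+1 + ((i.+1 == r + t) && (j == s))%N%:R).
Proof. by move=> t0 ts a; apply: I_up_sum. Qed.

Lemma down_I_rec t f i j : (0 < t)%N -> (t <= s)%N -> inI t i.+1 j.+1 ->
  down_I t f i.+1 j.+1 = ext (inI t) f i.+1 j.+1 *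
    (down_I t f i j.+1 + down_I t f i.+1 j + (i + j.+1 == t)%N%:R).
Proof. by move=> t0 ts a; apply: I_down_sum. Qed.

Lemma ext_erase_border t f i j : (0 < t)%N -> (t <= s)%N ->
  ext (inI t) (erase L f) i j =
  if (i.+1 == r + j)%N then 0 else ext (inI t) f i j.
Proof.
move=> t0 ts; rewrite !extE; case: ifP => a; last by case: ifP.
have b := inI_bound s_le_r t0 ts a.
by rewrite /erase mem_left_border; try lia.
Qed.

Lemma ext_erase_origin t f i j : (0 < t)%N -> (t <= s)%N ->
  ext (inI t) (erase (S t) f) i j =
  if ((i == t) && (j == 1) || (i.+1 == r + j))%N then 0 else ext (inI t) f i j.
Proof.
move=> t0 ts; rewrite !extE; case: ifP => a; last by case: ifP.
have b := inI_bound s_le_r t0 ts a.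
by rewrite /erase mem_origin_border; try lia.
Qed.

Lemma up_I_border t f i j : (0 < t)%N -> (t <= s)%N -> (i.+1 = r + j)%N ->
  up_I t (erase L f) i j = 0.
Proof.
move=> t0 ts ij; have [a|a] := boolP (inI t i j); last first.
  by rewrite up_I_out //; apply: negPf.
by rewrite up_I_rec // ext_erase_border // ij eqxx mul0r.
Qed.

Lemma down_I_border t f i j : (0 < t)%N -> (t <= s)%N -> (i.+1 = r + j)%N ->
  down_I t (erase (S t) f) i j = 0.
Proof.
move=> t0 ts; have [a|a] := boolP (inI t i j); last first.
  by move=> _; rewrite down_I_out //; apply: negPf.
case: i j a => [|i] [|j] a; try by move: a; rewrite /inI; lia.
by move=> ij; rewrite down_I_rec // ext_erase_origin // ij eqxx orbT mul0r.
Qed.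

Lemma down_I_origin t f : (0 < t)%N -> (t <= s)%N ->
  down_I t (erase (S t) f) t 1 = 0.
Proof.
case: t => // t _ ts; have [a|a] := boolP (inI t.+1 t.+1 1); last first.
  by rewrite down_I_out //; apply: negPf.
by rewrite down_I_rec // ext_erase_origin // !eqxx mul0r.
Qed.

(* On the upper side only the left border has to be erased, as no chain above
   a point contains the minimal element (t, 1). *)
Lemma polygon_form_pt t f g i j : (0 < t)%N -> (t <= s)%N -> inI t i j ->
  polygon_form (Iposet r s t) (S t) f g (pt r s i j) =
  down_I t f i j * up_I t g i j -
  down_I t (erase (S t) f) i j * up_I t (erase L g) i j.
Proof.
move=> t0 ts a; have b := inI_bound s_le_r t0 ts a.
rewrite /polygon_form /down_I /up_I !extE a; congr (_ - _).
have [/andP[/eqP it /eqP j1]|ij] := boolP ((i == t) && (j == 1))%N.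
  move: a; rewrite it j1 => a.
  have := down_I_origin f t0 ts; rewrite /down_I extE a => ->.
  by rewrite !mul0r.
congr (_ * _); apply: eq_up_sum => [|q].
  by rewrite in_Iposet // !ptE //; lia.
case: q => [[x hx] [y hy]]; rewrite in_Iposet // le_grid !ptE /=; try lia.
move=> qI xy; rewrite /erase /origin_border in_setU1 eq_pt /=; try lia.
by have -> : (x == t) && (y == 1)%N = false by move: ij a xy; rewrite /inI; lia.
Qed.

(* The summand is a virtual value 1 above the maximum of I_t, visible in the
   staircase only when k + 1 = s. *)
Definition shift_up t f a b : R :=
  up_I t f (a + k') b + (((a + k' + k.+1 == r + k + t) && (b == s.+1))%N%:R).

(* The summand is a virtual value 1 feeding the minimal elements of I_t that
   lie in M_k. *)
Definition shift_down t f a0 b0 a b : R :=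
  down_I t f (a + k') b + ((a == a0) && (b == b0))%N%:R.

(** * Chain sums on I_k and I_(k+1) as solutions of the staircase systems *)

Section OneLabel.
Variables (w : seq (grid r s)) (x : {ffun grid r s -> R}).
Hypotheses (w_lin : linear_extension M w) (x_gt0 : positive_on I' x).
Local Notation G := (fun a b => down_weight k' x (a + k') b).

Lemma stair_weight_down_weight : stair_weight (r - k) k.+1 G.
Proof.
split=> a b; rewrite stairE => ab; first exact: down_weight_gt0.
by rewrite /down_weight extE ab.
Qed.

(** A general f serves both the labels and their erasure on the left border. *)
Lemma shift_up_eq (free : bool) f :
  (forall i j, inM k i j -> free || (i.+1 < r + j)%N ->
     ext (inI k.+1) f i j = old_label k' x i j) ->
  (~~ free -> forall i j, (i.+1 = r + j)%N -> up_I k.+1 f i j = 0) ->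
  up_eq (r - k) k.+1 free G (shift_up k.+1 f).
Proof.
move=> fx f0; split=> [a b|b b0 bn].
  rewrite stairE => ab lt ff; rewrite /shift_up !addSn in ab *.
  rewrite (down_weight_rec ks s_le_r x ab); last by lia.
  rewrite up_I_rec //; last by move: ab; rewrite /inI /inM; lia.
  rewrite fx //; last by lia.
  have -> : (((a + k').+1 + k.+1 == r + k + k.+1) && (b.+1 == s.+1))%N = false.
    by move: ab; rewrite /inM; lia.
  have -> : (((a + k').+2 + k.+1 == r + k + k.+1) && (b.+1 == s.+1))%N = false.
    by move: ab; rewrite /inM; lia.
  have -> : (((a + k').+1 + k.+1 == r + k + k.+1) && (b.+2 == s.+1))%N =
            (((a + k').+2 == r + k.+1) && (b.+1 == s))%N by lia.
  by rewrite /=; ring.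
rewrite /shift_up; split=> [|ff].
  rewrite up_I_out; last by rewrite /inI; lia.
  have -> : ((b == s.+1))%N = false by lia.
  by rewrite andbF addr0.
rewrite f0 //; last by lia.
have -> : ((b == s.+1))%N = false by lia.
by rewrite andbF addr0.
Qed.

Lemma shift_up_dual_eq (free : bool) f :
  (forall i j, inM k i j -> free || (i.+1 < r + j)%N ->
     ext (inI k) f i j = new_label k' w x i j) ->
  (~~ free -> forall i j, (i.+1 = r + j)%N -> up_I k f i j = 0) ->
  up_dual_eq (r - k) k.+1 free G (shift_up k f).
Proof.
move=> fx f0; split=> [a b|]; last split=> [|b b0 bn].
- rewrite stairE => ab lt ff; rewrite /shift_up !addSn.
  rewrite (down_weightV_rec ks s_le_r w_lin x_gt0 ab); last by lia.
  rewrite up_I_rec //; last by move: ab lt; rewrite /inI /inM; lia.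
  rewrite fx //; last by lia.
  have -> : (((a + k') + k.+1 == r + k + k) && (b == s.+1))%N = false.
    by move: ab; rewrite /inM; lia.
  have -> : (((a + k').+1 + k.+1 == r + k + k) && (b == s.+1))%N = false.
    by move: ab; rewrite /inM; lia.
  have -> : (((a + k') + k.+1 == r + k + k) && (b.+1 == s.+1))%N =
            (((a + k').+1 == r + k) && (b == s))%N by lia.
  by rewrite /=; ring.
- rewrite /shift_up up_I_out; last by rewrite /inI; lia.
  have -> : ((k.+1 == s.+1))%N = false by lia.
  by rewrite andbF addr0.
rewrite /shift_up; split=> [|ff].
  rewrite up_I_out; last by rewrite /inI; lia.
  have -> : ((b == s.+1))%N = false by lia.
  by rewrite andbF addr0.
rewrite f0 //; last by lia.
have -> : ((b == s.+1))%N = false by lia.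
by rewrite andbF addr0.
Qed.

Lemma shift_down_eq :
  down_eq (r - k) k.+1 true G (shift_down k.+1 x 1 1).
Proof.
split=> [a b|]; last split=> [a|]; last split=> // b b0 bn.
- rewrite stairE => ab lt _; rewrite /shift_down !addSn in ab *.
  rewrite (down_weight_rec ks s_le_r x ab); last by lia.
  rewrite down_I_rec //; last by move: ab; rewrite /inI /inM; lia.
  have -> : ((a.+1 == 1) && (b.+1 == 1))%N = false by lia.
  (* The minimal elements (k + 1, 1) and (k, 2) of I_(k+1) are both fed by the virtual value in the
     corner (1, 1). *)
  have -> : (a + k' + b.+1 == k.+1 :> nat)%N =
      ((a == 1) && (b.+1 == 1) + (a.+1 == 1) && (b == 1))%N :> nat.
    by lia.
  by rewrite natrD /old_label /=; ring.
- rewrite /shift_down andbF addr0 down_I_out //.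
  by rewrite /inI; lia.
- split=> //; rewrite /shift_down down_I_out; last by rewrite /inI; lia.
  have -> : (((r - k + b).+1 == 1))%N = false by lia.
  by rewrite addr0.
Qed.

Lemma shift_down_eq_erased :
  down_eq (r - k) k.+1 false G (shift_down k.+1 (erase (S k.+1) x) 0 2).
Proof.
split=> [a b|]; last split=> [a|]; last split=> [_|b b0 bn].
- rewrite stairE => ab lt nb; rewrite /shift_down !addSn in ab *.
  rewrite (down_weight_rec ks s_le_r x ab); last by lia.
  rewrite down_I_rec //; last by move: ab; rewrite /inI /inM; lia.
  rewrite ext_erase_origin //.
  have -> : ((a.+1 == 0) && (b == 2))%N = false by lia.
  have -> : ((a.+1 == 0) && (b.+1 == 2))%N = false by lia.
  (* The minimal element (k + 1, 1) is erased, so the virtual value may feed only (k, 2); this is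
     why it sits at (0, 2). *)
  have [E|ne] := boolP ((a == 1) && (b == 0)).
    have -> : (((a + k').+1 == k.+1) && (b.+1 == 1))%N by lia.
    rewrite down_I_out; last by move: E; rewrite /inI; lia.
    rewrite down_I_out; last by move: E; rewrite /inI; lia.
    have -> : ((a == 0) && (b.+1 == 2))%N = false by lia.
    by rewrite /=; ring.
  have -> : (((a + k').+1 == k.+1) && (b.+1 == 1) ||
      ((a + k').+2 == r + b.+1))%N = false by move: ab; rewrite /inM; lia.
  have -> : ((a + k' + b.+1 == k.+1))%N = ((a == 0) && (b.+1 == 2))%N by lia.
  by rewrite /old_label /=; ring.
- rewrite /shift_down andbF addr0 down_I_out //.
  by rewrite /inI; lia.
- rewrite /shift_down down_I_out ?add0r //.
  by rewrite /inI; lia.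
- have bE : (r - k + b == 0)%N = false by lia.
  rewrite /shift_down bE; split; last by rewrite addr0 down_I_border //; lia.
  by rewrite down_I_out ?add0r //; rewrite /inI; lia.
Qed.

Lemma shift_down_dual_eq :
  down_dual_eq (r - k) k.+1 true G (shift_down k (zeta k w x) 0 1).
Proof.
split=> [a b|]; last split=> [a|b b0 bn].
- rewrite stairE => ab lt _; rewrite /shift_down !addSn in ab *.
  rewrite (down_weightV_rec ks s_le_r w_lin x_gt0 ab); last by lia.
  rewrite down_I_rec //; last by move: ab; rewrite /inI /inM; lia.
  have -> : ((a.+1 == 0) && (b == 1))%N = false by lia.
  have -> : ((a.+1 == 0) && (b.+1 == 1))%N = false by lia.
  have -> : ((a + k' + b.+1 == k))%N = ((a == 0) && (b.+1 == 1))%N by lia.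
  by rewrite /new_label /=; ring.
- rewrite /shift_down andbF addr0 down_I_out //.
  by rewrite /inI; lia.
- split=> //; rewrite /shift_down down_I_out; last by rewrite /inI; lia.
  by rewrite addr0.
Qed.

Lemma shift_down_dual_eq_erased :
  down_dual_eq (r - k) k.+1 false G
    (fun a b => down_I k (erase (S k) (zeta k w x)) (a + k') b).
Proof.
split=> [a b|]; last split=> [a|b b0 bn].
- rewrite stairE => ab lt nb; rewrite !addSn in ab *.
  rewrite (down_weightV_rec ks s_le_r w_lin x_gt0 ab); last by lia.
  rewrite down_I_rec //; last by move: ab; rewrite /inI /inM; lia.
  rewrite ext_erase_origin //.
  (* The only minimal element of I_k in M_k is (k, 1), which is erased; hence there is no virtual
     value in this function. *)
  have [E|ne] := boolP ((a == 0) && (b == 0)).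
    have -> : (((a + k').+1 == k) && (b.+1 == 1))%N by lia.
    rewrite down_I_out; last by move: E; rewrite /inI; lia.
    rewrite down_I_out; last by move: E; rewrite /inI; lia.
    by rewrite /=; ring.
  have -> : (((a + k').+1 == k) && (b.+1 == 1) ||
      ((a + k').+2 == r + b.+1))%N = false by move: ab; rewrite /inM; lia.
  have -> : ((a + k' + b.+1 == k))%N = false by lia.
  by rewrite /new_label /=; ring.
- by rewrite down_I_out //; rewrite /inI; lia.
- split; last by rewrite down_I_border //; lia.
  by rewrite down_I_out //; rewrite /inI; lia.
Qed.

(** Chains going down stay in columns left of t, whereas all of [origin_border] lies in columns from
    t on, as t <= r. *)
Lemma down_I_erased_left t f i j : (0 < t)%N -> (t <= s)%N -> (i < t)%N ->
  (t <= r)%N -> down_I t (erase (S t) f) i j = down_I t f i j.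
Proof.
move=> t0 ts it tr; elim: i j it => [|i IHi] j it.
  by rewrite !down_I_out // /inI; lia.
elim: j => [|j IHj]; first by rewrite !down_I_out // /inI; lia.
have [a|a] := boolP (inI t i.+1 j.+1); last first.
  by rewrite !down_I_out //; apply: negPf.
rewrite down_I_rec // [RHS]down_I_rec // ext_erase_origin //.
rewrite IHj IHi; last by lia.
have -> // : (i.+1 == t) && (j.+1 == 1) || (i.+2 == r + j.+1) = false by lia.
Qed.

(** In the columns left of k the two posets and their labels are translates by one row, and chains
    going down never leave these columns. *)
Lemma down_I_zeta_left i j : (i < k)%N ->
  down_I k (zeta k w x) i j = down_I k.+1 x i j.+1.
Proof.
move=> ik; elim: i j ik => [|i IHi] j ik.
  by rewrite !down_I_out // /inI; lia.
elim: j => [|j IHj]; first by rewrite !down_I_out // /inI; lia.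
have [a|a] := boolP (inI k i.+1 j.+1); last first.
  by rewrite !down_I_out //; move: a; rewrite /inI; lia.
rewrite down_I_rec // [RHS]down_I_rec //; last by move: a; rewrite /inI; lia.
rewrite IHj IHi; last by lia.
have := new_label_left ks s_le_r w x j.+1 ik.
rewrite /new_label /old_label => -> //.
by have -> : ((i + j.+2 == k.+1))%N = ((i + j.+1 == k))%N by lia.
Qed.

(** Above row k + 1 the two posets are translates by one column, and chains going up stay there. *)
Lemma up_I_up f g : (forall i j, (k.+1 < j)%N ->
    ext (inI k) f i j = ext (inI k.+1) g i.+1 j) ->
  forall i j, (k.+1 < j)%N -> up_I k f i j = up_I k.+1 g i.+1 j.
Proof.
move=> fg i j.
move: {2}(r + s + r + s - i - j)%N (erefl (r + s + r + s - i - j)%N) => c.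
elim: c i j => [|c IH] i j ij kj.
  by rewrite !up_I_out // /inI; lia.
have [a|a] := boolP (inI k i j); last first.
  by rewrite !up_I_out //; move: a; rewrite /inI; lia.
have b := inI_bound s_le_r k_gt0 ks_le a.
rewrite up_I_rec // [RHS]up_I_rec //; last by move: a; rewrite /inI; lia.
rewrite fg // !IH //; try lia.
by have -> : ((i.+2 == r + k.+1))%N = ((i.+1 == r + k))%N by lia.
Qed.

End OneLabel.

(** * Transport of the polygonal identity from I_(k+1) to I_k *)

Section Labels.
Variables (w v' : seq (grid r s)) (x : {ffun grid r s -> R}).
Hypotheses (w_lin : linear_extension M w) (v'_lin : linear_extension I' v').
Hypothesis (x_gt0 : positive_on I' x).

Local Notation y := (toggles (meeting I' (S k.+1)) v' x).
Local Notation zx := (zeta k w x).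
Local Notation zy := (zeta k w y).

(** Every point lies on a polygonal chain: one through the border point of its row up to row k + 1,
    one through (k + 1, 1) in higher rows. *)
Lemma polygonal_toggles_gt0 : positive_on I' y.
Proof.
have [_ v'P _] := v'_lin.
apply: toggles_meeting_positive => // [q|]; first by rewrite v'P.
move=> [[i hi] [j hj]] pI; move: (pI); rewrite in_I' //= => a.
have [jk|kj] := leqP j k.+1.
  apply: (comparable_meeting (q := pt r s (r + j - 1)%N j)) => //.
  - by rewrite in_I' // !ptE; move: a; rewrite /inI; lia.
  - by rewrite mem_origin_border; move: a; rewrite /inI; lia.
  - apply: le_comparable; rewrite le_grid !ptE /=;
      by move: a; rewrite /inI; lia.
apply: (comparable_meeting (q := pt r s k.+1 1)) => //.
- by rewrite in_I' // !ptE; move: a; rewrite /inI; lia.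
- by rewrite mem_origin_border; move: a; rewrite /inI; lia.
- by apply: ge_comparable; rewrite le_grid !ptE /=; move: a; rewrite /inI; lia.
Qed.

Lemma polygonal_toggles_form i j : inI k.+1 i j ->
  down_I k.+1 y i j * up_I k.+1 x i j -
  down_I k.+1 (erase (S k.+1) y) i j * up_I k.+1 (erase L x) i j = 1.
Proof.
move=> a; rewrite -polygon_form_pt //; have b := inI_bound s_le_r _ ks a.
have pI : pt r s i j \in I' by rewrite in_I' // !ptE //; lia.
by apply: toggles_polygon => // p /polygonal_toggles_gt0/lt0r_neq0.
Qed.

Local Notation U := (shift_up k.+1 x).
Local Notation U0 := (shift_up k.+1 (erase L x)).
Local Notation V := (shift_up k zx).
Local Notation V0 := (shift_up k (erase L zx)).
Local Notation D := (shift_down k.+1 y 1 1).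
Local Notation D0 := (shift_down k.+1 (erase (S k.+1) y) 0 2).
Local Notation E := (shift_down k zy 0 1).
Local Notation E0 := (fun a b => down_I k (erase (S k) zy) (a + k') b).

Lemma up_I_zeta_above i j : (k.+1 < j)%N ->
  up_I k zx i j = up_I k.+1 x i.+1 j /\
  up_I k (erase L zx) i j = up_I k.+1 x i.+1 j.
Proof.
move=> kj; split; apply: up_I_up => // {}i {}j {}kj.
  exact: (new_label_up ks s_le_r w x i kj).
rewrite ext_erase_border //.
case: ifP => [/eqP ij|_]; last exact: (new_label_up ks s_le_r w x i kj).
by rewrite extE (_ : inI _ _ _ = false) // /inI; lia.
Qed.

(** The rows of I_(k+1) above row k + 1 contain no point of the left border. *)
Lemma up_I_erased_above i j : (k.+1 < j)%N ->
  up_I k.+1 (erase L x) i j = up_I k.+1 x i j.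
Proof.
case: i => [|i] kj; first by rewrite !up_I_out.
have [_ <-] := up_I_zeta_above i kj; symmetry.
apply: up_I_up => // {}i {}j {}kj.
rewrite !ext_erase_border //.
have := new_label_up ks s_le_r w x i kj; rewrite /new_label /old_label => ->.
have [a|a] := boolP (inI k.+1 i.+1 j).
  have -> : (i.+1 == r + j)%N = false by move: a; rewrite /inI; lia.
  by have -> : (i.+2 == r + j)%N = false by move: a; rewrite /inI; lia.
by rewrite extE (negPf a); do 2 case: ifP => // _.
Qed.

Lemma zeta_pairing :
  [/\ forall i j, inM k i j -> (i + j < r + k + k.+1)%N ->
        down_I k zy i j * up_I k zx i j -
        down_I k (erase (S k) zy) i j * up_I k (erase L zx) i j = 1,
      forall j, (0 < j)%N -> (j <= k.+1)%N ->
        up_I k zx k j - up_I k (erase L zx) k j =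
        up_I k.+1 x k j.+1 - up_I k.+1 (erase L x) k j.+1 &
      forall i, (k <= i)%N -> (i < r + k)%N ->
        down_I k zy i k.+1 - down_I k (erase (S k) zy) i k.+1 =
        down_I k.+1 y i.+1 k.+1 - down_I k.+1 (erase (S k.+1) y) i.+1 k.+1].
Proof.
have yp := polygonal_toggles_gt0.
have [|||||||||||||||||||||||h1 h2 h3] := @pairing R (r - k) k.+1 _ _
  (fun a b => down_weight k' x (a + k') b)
  (fun a b => down_weight k' y (a + k') b) U U0 V V0 D D0 E E0; try by lia.
- exact: stair_weight_down_weight.
- exact: stair_weight_down_weight.
- by rewrite add1n down_weight_min.
- exact: shift_up_eq.
- apply: shift_up_eq => [i j a|_ i j]; last exact: up_I_border.
  by rewrite ext_erase_border // => /= ij; rewrite ltn_eqF.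
- apply: (shift_up_dual_eq w_lin x_gt0) => //.
- apply: (shift_up_dual_eq w_lin x_gt0) => // [i j a|_ i j]; last first.
    exact: up_I_border.
  by rewrite ext_erase_border // => /= ij; rewrite ltn_eqF.
- exact: shift_down_eq.
- exact: shift_down_eq_erased.
- exact: shift_down_dual_eq.
- exact: shift_down_dual_eq_erased.
- by move=> a _; rewrite /shift_up up_I_erased_above.
- move=> a a0 am; rewrite /shift_up !addSn.
  have [-> ->] := up_I_zeta_above (a + k') (ltnSn k.+1).
  by have -> : (a + k' + k.+1 == r + k + k)%N =
    ((a + k').+1 + k.+1 == r + k + k.+1)%N by lia.
(* This goal and the next two evaluate virtual values: 1 at (1, 1) for D, then at (0, 2) the values
   0 for D and 1 for D0. *)
- rewrite /shift_down down_I_out ?add0r //.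
  by rewrite /inI; lia.
- rewrite /shift_down down_I_out ?add0r //.
  by rewrite /inI; lia.
- rewrite /shift_down down_I_out ?add0r //.
  by rewrite /inI; lia.
- move=> b b2; rewrite /shift_down down_I_erased_left //; try by lia.
  by rewrite /= (_ : (b == 2) = false) //; lia.
- move=> b b0 bk; rewrite /shift_down down_I_erased_left //; try by lia.
  rewrite down_I_erased_left; try by lia.
  by rewrite down_I_zeta_left // eqSS addr0.
- by rewrite /shift_down down_I_erased_left ?addr0 //; lia.
- move=> a b; rewrite stairE => ab ab2; rewrite /shift_down /shift_up.
  have -> : (b == s.+1) = false by move: ab; rewrite /inM; lia.
  have -> : (a == 1) && (b == 1) = false by lia.
  have -> : (a == 0) && (b == 2) = false by move: ab; rewrite /inM; lia.
  rewrite !andbF !addr0 polygonal_toggles_form //.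
  by move: ab; rewrite /inM /inI; lia.
split=> [i j a ij|j j0 jk|i ki ik].
- have ik : (k' <= i)%N by move: a; rewrite /inM; lia.
  have := h1 (i - k')%N j; rewrite stairE /shift_down /shift_up subnK //.
  have -> : (j == s.+1) = false by move: a; rewrite /inM; lia.
  have -> : (i - k' == 0)%N = false by move: a; rewrite /inM; lia.
  by rewrite !andbF !addr0; apply=> //; lia.
- have := h2 j j0 jk; rewrite /shift_up !add1n.
  have -> : (j == s.+1) = false by lia.
  have -> : (k + k.+1 == r + k + k.+1)%N = false by lia.
  by rewrite !andbF !addr0.
- have := h3 (i - k')%N; rewrite /shift_down addSn subnK; last by lia.
  have -> : (i - k' == 0)%N = false by lia.
  by rewrite !andbF !addr0; apply; lia.
Qed.

(** No border point occurs in the columns left of k, so full and restricted sums obey one linear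
    recursion there, and their difference propagates from column k. *)
Lemma up_difference_left i j : (i <= k)%N -> (0 < j)%N -> (j <= k.+1)%N ->
  up_I k zx i j - up_I k (erase L zx) i j =
  up_I k.+1 x i j.+1 - up_I k.+1 (erase L x) i j.+1.
Proof.
move: {2}(k + k.+1 - i - j)%N (erefl (k + k.+1 - i - j)%N) => c.
elim: c i j => [|c IH] i j ij ik j0 jk.
  have -> : i = k by lia.
  by have [_ + _] := zeta_pairing; apply.
have [ik'|ki] := ltnP i k; last first.
  have -> : i = k by lia.
  by have [_ + _] := zeta_pairing; apply.
have [a|a] := boolP (inI k i j); last first.
  by rewrite !up_I_out //; move: a; rewrite /inI; lia.
have a' : inI k.+1 i j.+1 by move: a; rewrite /inI; lia.
have jk' : (j <= k)%N by move: a; rewrite /inI; lia.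
have h1 := IH i.+1 j ltac:(lia) ltac:(lia) j0 jk.
have h2 := IH i j.+1 ltac:(lia) ik isT ltac:(lia).
rewrite (up_I_rec _ _ _ a) // (up_I_rec (erase L zx) _ _ a) //.
rewrite (up_I_rec _ _ _ a') // (up_I_rec (erase L x) _ _ a') //.
rewrite !ext_erase_border //.
have -> : (i.+1 == r + j)%N = false by lia.
have -> : (i.+1 == r + j.+1)%N = false by lia.
have -> : (i.+1 == r + k)%N = false by lia.
have -> : (i.+1 == r + k.+1)%N = false by lia.
have := new_label_left ks s_le_r w x j ik'; rewrite /new_label /old_label => ->.
rewrite /= !addr0 -!mulrBr; congr (_ * _).
by rewrite !opprD !addrA -!(addrA _ _ (- _)); lra.
Qed.

(** Likewise no erased point occurs above row k + 1, and the difference propagates from that row. *)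
Lemma down_difference_above i j : (k <= i)%N -> (k < j)%N ->
  down_I k zy i j - down_I k (erase (S k) zy) i j =
  down_I k.+1 y i.+1 j - down_I k.+1 (erase (S k.+1) y) i.+1 j.
Proof.
move=> ki kj; elim: j i ki kj => // j IHj i ki kj.
have [jk|] := leqP j k.
  have -> : j = k by lia.
  have [ik|ri] := ltnP i (r + k); first by have [_ _] := zeta_pairing; apply.
  by rewrite !down_I_out // /inI; lia.
move=> kj'; have {}IHj i' (ki' : (k <= i')%N) := IHj i' ki' kj'.
elim: i ki => // i IHi ki.
have [a|a] := boolP (inI k i.+1 j.+1); last first.
  by rewrite !down_I_out //; move: a; rewrite /inI; lia.
have a' : inI k.+1 i.+2 j.+1 by move: a; rewrite /inI; lia.
rewrite (down_I_rec _ _ _ a) // (down_I_rec (erase (S k) zy) _ _ a) //.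
rewrite (down_I_rec _ _ _ a') // (down_I_rec (erase (S k.+1) y) _ _ a') //.
rewrite !ext_erase_origin //.
have -> : (i.+1 == k) && (j.+1 == 1) || (i.+2 == r + j.+1)%N = false.
  by move: a; rewrite /inI; lia.
have -> : (i.+2 == k.+1) && (j.+1 == 1) || (i.+3 == r + j.+1)%N = false.
  by move: a; rewrite /inI; lia.
have := new_label_up ks s_le_r w y i.+1 (j := j.+1) kj'.
rewrite /new_label /old_label => ->.
have -> : (i + j.+1 == k)%N = false by lia.
have -> : (i.+1 + j.+1 == k.+1)%N = false by lia.
rewrite /= !addr0 -!mulrBr; congr (_ * _).
have h1 := IHj i.+1 ki.
have h2 : down_I k zy i j.+1 - down_I k (erase (S k) zy) i j.+1 =
    down_I k.+1 y i.+1 j.+1 - down_I k.+1 (erase (S k.+1) y) i.+1 j.+1.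
  have [ki'|ik] := leqP k i; first exact: IHi.
  by rewrite !down_I_out // /inI; lia.
lra.
Qed.

(** Above row k + 1 the up sums factor out of the form, left of column k the down sums do, and each
    time a transported difference remains; on the rest it is the pairing. *)
Lemma polygon_zeta : {in I, forall p, polygon_form I (S k) zy zx p = 1}.
Proof.
move=> p; rewrite in_I // => pI.
have [i [j [-> a]]] : exists i j, p = pt r s i j /\ inI k i j.
  by exists p.1, p.2; rewrite pt_val.
rewrite polygon_form_pt // {p pI}.
have [h1 _ _] := zeta_pairing.
have [jk|kj] := leqP j k.+1; last first.
  have [-> ->] := up_I_zeta_above i kj.
  have ki : (k <= i)%N by move: a; rewrite /inI; lia.
  have a' : inI k.+1 i.+1 j by move: a; rewrite /inI; lia.
  rewrite -mulrBl down_difference_above //; last by lia.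
  by rewrite mulrBl -{2}up_I_erased_above // polygonal_toggles_form.
have [ik|ki] := ltnP i k; last first.
  by apply: h1; move: a; rewrite /inI /inM; lia.
have a' : inI k.+1 i j.+1 by move: a; rewrite /inI; lia.
have j0 : (0 < j)%N by move: a; rewrite /inI; lia.
rewrite down_I_erased_left //; last by lia.
rewrite -mulrBr up_difference_left // ?(ltnW ik) //.
rewrite down_I_zeta_left //.
have := polygonal_toggles_form a'; rewrite down_I_erased_left //; last by lia.
  by rewrite -mulrBr.
by lia.
Qed.

End Labels.
End Equivariance.

Unset Implicit Arguments.

Theorem theorem5p2 (R : realType) (r s : nat) (s_gt0 : (0 < s)%N)
    (s_le_r : (s <= r)%N) (k : nat) (k_gt0 : (1 <= k)%N)
    (k_le : (k <= s - 1)%N)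
    (v' v w : seq (grid r s))
    (v'_lin : linear_extension (Iposet r s k.+1) v')
    (v_lin : linear_extension (Iposet r s k) v)
    (w_lin : linear_extension (Mposet r s k) w)
    (x : {ffun grid r s -> R}) (x_gt0 : positive_on (Iposet r s k.+1) x) :
  {in Iposet r s k,
    zeta k w (polygonal_rowmotion k.+1 v' x) =1
    polygonal_rowmotion k v (zeta k w x)}.
Proof.
case: k k_gt0 k_le v'_lin v_lin w_lin x_gt0 => // k _ k_le.
move=> v'_lin v_lin w_lin x_gt0.
have ks : (k.+1 < s)%N by lia.
move=> p pI; rewrite /polygonal_rowmotion !polygonal_chainsE.
by rewrite (polygon_toggles v_lin (polygon_zeta ks s_le_r w_lin v'_lin x_gt0)).
Qed.
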